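(* Let $R$ be a commutative noetherian ring and $M$ a finitely generated $R$-module. Then the following are equivalent. (1) The natural homomorphism $\iota\colon R\to Z_R(M)$ is an isomorphism. (2) $Z_R(M)\cong R$ as $R$-algebras. (3) $Z_R(M)\cong R$ as $R$-modules. (4) $M\neq0$ and $Z_R(M)$ is a free $R$-module. (5) $\operatorname{Supp}M=\operatorname{Spec}R$ and $Z_R(M)$ is a projective $R$-module. (6) $\operatorname{Ass}_R Z_R(M)=\operatorname{Ass}R$ and $Z_{R_{\mathfrak p}}(M_{\mathfrak p})$ is $R_{\mathfrak p}$-free for all $\mathfrak p\in\operatorname{Spec}R$ such that $\operatorname{depth}R_{\mathfrak p}\le1$.
   Context: For a commutative noetherian ring $R$ and a finitely generated $R$-module $M$, $Z_R(M)$ denotes the center of the endomorphism ring $\operatorname{End}_R(M)$, regarded as a commutative $R$-algebra; the natural homomorphism $R\to Z_R(M)$ sends $r$ to multiplication by $r$.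
   Formalization: The ring R is assumed nonzero: for R = 0 one has M = 0 and Z_R(M) = 0 = R, so (1) holds while (4) fails because it requires M ≠ 0. *)

(* Defs.v *)
From HB Require Import structures.
From mathcomp Require Import all_boot all_order all_algebra.
From mathcomp Require Import generic_quotient ring_quotient.
From mathcomp Require Import boolp classical_sets constructive_ereal.
From mathcomp Require Import ring.

Set Implicit Arguments.
Unset Strict Implicit.
Unset Printing Implicit Defensive.

Import GRing.Theory.
Local Open Scope classical_set_scope.
Local Open Scope ring_scope.

(* Throughout, R-modules are [lmodType R], R as a module over itself is [R^o],
   and prime ideals are the library's [prime_idealr R] (they are given by
   boolean predicates, which is no restriction in classical logic). *)

Section Modules.
Variable R : comNzRingType.

(* The coefficients are indexed by positions, so that [s] may have repetitions. *)
Definition in_span (V : lmodType R) (s : seq V) (x : V) : Prop :=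
  exists c : 'I_(size s) -> R, x = \sum_(i < size s) c i *: s`_i.

Definition finitely_generated (V : lmodType R) : Prop :=
  exists s : seq V, forall x, in_span s x.

Definition linearly_independent (V : lmodType R) (B : set V) : Prop :=
  forall (s : seq V) (c : V -> R), uniq s -> (forall v, v \in s -> B v) ->
    \sum_(v <- s) c v *: v = 0 -> forall v, v \in s -> c v = 0.

Definition generating (V : lmodType R) (B : set V) : Prop :=
  forall x, exists s : seq V, (forall v, v \in s -> B v) /\ in_span s x.

Definition free_module (V : lmodType R) : Prop :=
  exists B : set V, linearly_independent B /\ generating B.

Definition projective_module (V : lmodType R) : Prop :=
  forall (N P : lmodType R) (g : {linear N -> P}) (f : {linear V -> P}),
    (forall y, exists x, g x = y) ->
    exists h : {linear V -> N}, forall v, g (h v) = f v.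

Definition Ass (V : lmodType R) (p : prime_idealr R) : Prop :=
  exists x : V, forall a, (a \in p) = (a *: x == 0).

End Modules.

(* The ideals of R, including R itself, are the submodules of R^o. *)
Definition noetherian (R : comNzRingType) : Prop :=
  forall I : {pred R^o}, GRing.submod_closed I ->
    exists s : seq R^o, forall x, x \in I <-> in_span s x.

Section Depth.
Variable A : comNzRingType.

Definition nonunits : set A := [set a | forall b, b * a <> 1].

Definition regular_sequence (s : seq A) : Prop :=
  (forall i, (i < size s)%N -> forall x : A,
     in_span (take i s : seq A^o) (s`_i * x) ->
     in_span (take i s : seq A^o) x)
  /\ ~ in_span (s : seq A^o) 1.

(* The depth of a local ring A, whose maximal ideal is the set of nonunits: the
   supremum, possibly +oo, of the lengths of the regular sequences in it. *)
Definition depth : \bar int :=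
  supremum 0%E
    [set (size s : int)%:E | s in
       [set s : seq A | (forall a, a \in s -> nonunits a) /\
                        regular_sequence s]].

Lemma depth_le (n : nat) :
  (depth <= (n : int)%:E)%E <->
  (forall s : seq A, (forall a, a \in s -> nonunits a) ->
     regular_sequence s -> (size s <= n)%N).
Proof.
rewrite /depth; set S := [set s : seq A | _]; set T := (X in supremum _ X).
have [y Sy] : supremums T !=set0.
  have [[m bm]|nb] := pselect (exists m, forall s, S s -> (size s <= m)%N).
    have [[s0 Ss0]|nS] := pselect (exists s, S s); last first.
      exists -oo%E; split => [x [s Ss _]|z _]; last exact: leNye.
      by case: nS; exists s.
    have exP : exists k, `[< exists s, S s /\ size s = k >].
      by exists (size s0); apply/asboolP; exists s0.
    have ubP k : `[< exists s, S s /\ size s = k >] -> (k <= m)%N.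
      by move=> /asboolP[s [Ss <-]]; exact: bm.
    have [k /asboolP[s [Ss sk]] kmax] := ex_maxnP exP ubP.
    exists (k : int)%:E; split => [_ [t St <-]|z Tz].
      by rewrite lee_fin lez_nat kmax//; apply/asboolP; exists t.
    by rewrite -sk; apply: Tz; exists s.
  exists +oo%E; split => [x _|[r| |] zu]; rewrite ?leey//; exfalso; apply: nb.
    exists `|r|%N => s Ss; have /zu : T (size s : int)%:E by exists s.
    rewrite lee_fin => h; rewrite -lez_nat gez0_abs//.
    by apply: Order.POrderTheory.le_trans h.
  by exists 0%N => s Ss; have /zu : T (size s : int)%:E by exists s.
split=> [dn s sm sreg|sn].
  have Ts : T (size s : int)%:E by exists s.
  have := Order.POrderTheory.le_trans
    (ge_supremum_Nmem 0%E (ex_intro _ y Sy) Ts) dn.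
  by rewrite lee_fin lez_nat.
rewrite /supremum; case: ifP => _; first by rewrite lee_fin.
case: xgetP => [z _ [_ lz]|/(_ y)//].
by apply: lz => _ [s [sm sreg] <-]; rewrite lee_fin lez_nat sn.
Qed.

End Depth.

Section Endomorphisms.
Variables (R : comNzRingType) (M : lmodType R).

Definition End := {linear M -> M}.
HB.instance Definition _ := gen_eqMixin End.
HB.instance Definition _ := gen_choiceMixin End.

Lemma End_ext (f g : End) : (forall x, f x = g x) -> f = g.
Proof.
case: f g => [f [[af] [lf]]] [g [[ag] [lg]]] /= /funext fg; subst g.
by rewrite (Prop_irrelevance af ag) (Prop_irrelevance lf lg).
Qed.

Let zero : End := \0.
Let opp (f : End) : End := \- f.
Let add (f g : End) : End := f \+ g.

Fact End_addA : associative add.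
Proof. by move=> f g h; apply: End_ext => x; rewrite /= addrA. Qed.
Fact End_addC : commutative add.
Proof. by move=> f g; apply: End_ext => x; rewrite /= addrC. Qed.
Fact End_add0 : left_id zero add.
Proof. by move=> f; apply: End_ext => x; rewrite /= add0r. Qed.
Fact End_addN : left_inverse zero opp add.
Proof. by move=> f; apply: End_ext => x; rewrite /= addNr. Qed.
HB.instance Definition _ :=
  GRing.isZmodule.Build End End_addA End_addC End_add0 End_addN.

Let one : End := idfun.
Let mul (f g : End) : End := f \o g.

Fact End_mulA : associative mul.
Proof. by move=> f g h; apply: End_ext. Qed.
Fact End_mul1 : left_id one mul.
Proof. by move=> f; apply: End_ext. Qed.
Fact End_mulr1 : right_id one mul.
Proof. by move=> f; apply: End_ext. Qed.
Fact End_mulDl : left_distributive mul +%R.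
Proof. by move=> f g h; apply: End_ext. Qed.
Fact End_mulDr : right_distributive mul +%R.
Proof. by move=> f g h; apply: End_ext => x; rewrite /= raddfD. Qed.
HB.instance Definition _ := GRing.Zmodule_isPzRing.Build End
  End_mulA End_mul1 End_mulr1 End_mulDl End_mulDr.

Let scale (a : R) (f : End) : End := a \*: f.

Fact End_scaleA a b f : scale a (scale b f) = scale (a * b) f.
Proof. by apply: End_ext => x; rewrite /= scalerA. Qed.
Fact End_scale1 : left_id 1 scale.
Proof. by move=> f; apply: End_ext => x; rewrite /= scale1r. Qed.
Fact End_scaleDr : right_distributive scale +%R.
Proof. by move=> a f g; apply: End_ext => x; rewrite /= scalerDr. Qed.
Fact End_scaleDl f : {morph scale^~ f : a b / a + b}.
Proof. by move=> a b; apply: End_ext => x; rewrite /= scalerDl. Qed.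
HB.instance Definition _ := GRing.Zmodule_isLmodule.Build R End
  End_scaleA End_scale1 End_scaleDr End_scaleDl.

Lemma End_addE (f g : End) x : (f + g) x = f x + g x. Proof. by []. Qed.
Lemma End_mulE (f g : End) x : (f * g) x = f (g x). Proof. by []. Qed.
Lemma End_oneE x : (1 : End) x = x. Proof. by []. Qed.
Lemma End_scaleE a (f : End) x : (a *: f) x = a *: f x. Proof. by []. Qed.

Definition homothety (a : R) : End := *:%R a.

Definition central : {pred End} :=
  [pred f | `[< forall g : End, f * g = g * f >]].

Lemma centralP (f : End) :
  reflect (forall g : End, f * g = g * f) (f \in central).
Proof. exact: asboolP. Qed.

Fact central_subring : subring_closed central.
Proof.
split=> [|f g /centralP cf /centralP cg|f g /centralP cf /centralP cg].
- by apply/centralP => h; rewrite mul1r mulr1.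
- by apply/centralP => h; rewrite mulrBl mulrBr cf cg.
- by apply/centralP => h; rewrite -mulrA cg mulrA cf mulrA.
Qed.
Fact central_scale : GRing.scaler_closed central.
Proof.
move=> a f /centralP cf; apply/centralP => g; apply: End_ext => x.
have := congr1 (fun h : End => a *: h x) (cf g).
by rewrite /= => h; rewrite [RHS]linearZ; exact: h.
Qed.
Fact central_submod : GRing.subsemimod_closed central.
Proof.
split; last exact: central_scale.
have [c1 cB _] := central_subring; have c0 : 0 \in central.
  by rewrite -(subrr (1 : End)); apply: cB.
split=> // f g cf cg; have -> : f + g = f - (0 - g) by rewrite sub0r opprK.
by apply: (cB) => //; apply: cB.
Qed.

Definition End_center := {f : End | f \in central}.
HB.instance Definition _ := SubChoice.on End_center.
HB.instance Definition _ :=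
  GRing.SubChoice_isSubPzRing.Build End central End_center central_subring.
HB.instance Definition _ :=
  GRing.SubZmodule_isSubLmodule.Build R End central End_center central_submod.

Fact End_center_mulC : commutative (@GRing.mul End_center).
Proof. by move=> f g; apply: val_inj; apply/centralP/(valP f). Qed.
HB.instance Definition _ :=
  GRing.PzRing_hasCommutativeMul.Build End_center End_center_mulC.

Fact homothety_central a : homothety a \in central.
Proof.
by apply/centralP => g; apply: End_ext => x; rewrite !End_mulE /= linearZ.
Qed.

(* The natural homomorphism from R to Z_R(M), the ring [End_center M]. *)
Definition to_End_center (a : R) : End_center :=
  exist _ (homothety a) (homothety_central a).

Fact to_End_center_additive : zmod_morphism to_End_center.
Proof.
by move=> a b; apply: val_inj; apply: End_ext => x /=; rewrite scalerBl.
Qed.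
Fact to_End_center_multiplicative : monoid_morphism to_End_center.
Proof.
split=> [|a b]; apply: val_inj; apply: End_ext => x /=; first exact: scale1r.
by rewrite -scalerA.
Qed.
HB.instance Definition _ :=
  GRing.isZmodMorphism.Build R End_center to_End_center to_End_center_additive.
HB.instance Definition _ :=
  GRing.isMonoidMorphism.Build R End_center to_End_center
    to_End_center_multiplicative.

Lemma to_End_center_algebra a : to_End_center a = a *: (1 : End_center).
Proof. by apply: val_inj; apply: End_ext. Qed.

End Endomorphisms.

(* [locmod p M] is the localization M_p, the set of fractions x / s with s outside
   p, where x / s = y / t iff u t x = u s y for some u outside p.  The ring R_p is
   [locring p]; its carrier is the localization of the module R^o. *)
Section Denominators.
Variables (R : comNzRingType) (p : prime_idealr R).

Definition denom := {s : R | s \notin p}.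
Definition den (s : denom) : R := val s.

Lemma denP s : den s \notin p. Proof. exact: (valP s). Qed.

Fact denom1_proof : (1 : R) \notin p. Proof. by rewrite idealr1. Qed.
Definition denom1 : denom := exist (fun s : R => s \notin p) 1 denom1_proof.

Fact denomM_proof (s t : denom) : den s * den t \notin p.
Proof. by rewrite prime_idealrM negb_or !denP. Qed.
Definition denomM (s t : denom) : denom :=
  exist (fun s : R => s \notin p) _ (denomM_proof s t).

Lemma den1 : den denom1 = 1. Proof. by []. Qed.

Lemma denM s t : den (denomM s t) = den s * den t. Proof. by []. Qed.

End Denominators.

Arguments den : simpl never.

Section LocalizedModule.
Variables (R : comNzRingType) (p : prime_idealr R) (M : lmodType R).
Local Notation denom := (denom p).

Definition loc_equiv (x y : M * denom) : bool :=
  `[< exists u : denom,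
        (den u * den y.2) *: x.1 = (den u * den x.2) *: y.1 >].

Fact loc_equiv_refl : reflexive loc_equiv.
Proof. by move=> x; apply/asboolP; exists (denom1 p). Qed.

Fact loc_equiv_sym : symmetric loc_equiv.
Proof. by move=> x y; apply: asbool_equiv_eq; split=> -[u e]; exists u. Qed.

Fact loc_equiv_trans : transitive loc_equiv.
Proof.
move=> y x z /asboolP[u e] /asboolP[v f]; apply/asboolP.
exists (denomM (denomM u v) y.2); rewrite /= !denM.
transitivity ((den v * den z.2) *: ((den u * den y.2) *: x.1)).
  by rewrite scalerA; congr (_ *: _); rewrite ?denM ?den1; ring.
rewrite e; transitivity ((den u * den x.2) *: ((den v * den z.2) *: y.1)).
  by rewrite !scalerA; congr (_ *: _); rewrite ?denM ?den1; ring.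
by rewrite f scalerA; congr (_ *: _); rewrite ?denM ?den1; ring.
Qed.

Canonical loc_equivRel :=
  EquivRel loc_equiv loc_equiv_refl loc_equiv_sym loc_equiv_trans.

Definition locmod := {eq_quot loc_equiv}%qT.
HB.instance Definition _ : EqQuotient _ loc_equiv locmod :=
  EqQuotient.on locmod.
HB.instance Definition _ := Choice.on locmod.

Definition mkfrac (x : M) (s : denom) : locmod := (\pi_locmod (x, s))%qT.

Lemma mkfracP x s y t :
  mkfrac x s = mkfrac y t <->
  exists u : denom, (den u * den t) *: x = (den u * den s) *: y.
Proof.
split=> [/eqP|h]; first by rewrite eqmodE => /asboolP.
by apply/eqP; rewrite eqmodE; apply/asboolP.
Qed.

Lemma mkfrac_eq x s y t : den t *: x = den s *: y -> mkfrac x s = mkfrac y t.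
Proof. by move=> e; apply/mkfracP; exists (denom1 p); rewrite den1 !mul1r. Qed.

Lemma mkfrac_ind (P : locmod -> Prop) :
  (forall x s, P (mkfrac x s)) -> forall z, P z.
Proof. by move=> h z; rewrite -[z]reprK; case: (repr z) => x s; exact: h. Qed.

Lemma repr_mkfrac x s : exists u : denom,
  (den u * den s) *: (repr (mkfrac x s)).1 =
  (den u * den (repr (mkfrac x s)).2) *: x.
Proof.
apply/mkfracP; rewrite -[RHS]reprK /mkfrac.
by case: (repr _) => y t.
Qed.

End LocalizedModule.

Section LocalizedStructure.
Variables (R : comNzRingType) (p : prime_idealr R) (M : lmodType R).
Local Notation denom := (denom p).
Local Notation Mp := (locmod p M).

Definition loc_zero : Mp := mkfrac 0 (denom1 p).

Definition loc_add (z w : Mp) : Mp :=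
  mkfrac (den (repr w).2 *: (repr z).1 + den (repr z).2 *: (repr w).1)
         (denomM (repr z).2 (repr w).2).

Definition loc_opp (z : Mp) : Mp := mkfrac (- (repr z).1) (repr z).2.

Definition loc_scale (a : locmod p R^o) (z : Mp) : Mp :=
  mkfrac (((repr a).1 : R) *: (repr z).1) (denomM (repr a).2 (repr z).2).

Lemma loc_addE x (s : denom) y (t : denom) :
  loc_add (mkfrac x s) (mkfrac y t) =
  mkfrac (den t *: x + den s *: y) (denomM s t).
Proof.
rewrite /loc_add; have [u] := repr_mkfrac x s; have [v] := repr_mkfrac y t.
case: (repr (mkfrac x s)) => x' s'; case: (repr (mkfrac y t)) => y' t' /= ey ex.
apply/mkfracP; exists (denomM u v); rewrite /= ?denM; rewrite !scalerDr !scalerA.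
congr (_ + _).
  transitivity ((den v * den t * den t') *: ((den u * den s) *: x')).
    by rewrite scalerA; congr (_ *: _); rewrite ?denM ?den1; ring.
  by rewrite ex scalerA; congr (_ *: _); rewrite ?denM ?den1; ring.
transitivity ((den u * den s * den s') *: ((den v * den t) *: y')).
  by rewrite scalerA; congr (_ *: _); rewrite ?denM ?den1; ring.
by rewrite ey scalerA; congr (_ *: _); rewrite ?denM ?den1; ring.
Qed.

Lemma loc_oppE x (s : denom) : loc_opp (mkfrac x s) = mkfrac (- x) s.
Proof.
rewrite /loc_opp; have [u] := repr_mkfrac x s.
case: (repr (mkfrac x s)) => x' s' /= ex.
by apply/mkfracP; exists u; rewrite !scalerN ex.
Qed.

Lemma loc_scaleE (a : R^o) (s : denom) x (t : denom) :
  loc_scale (mkfrac a s) (mkfrac x t) = mkfrac ((a : R) *: x) (denomM s t).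
Proof.
rewrite /loc_scale; have [u] := repr_mkfrac a s; have [v] := repr_mkfrac x t.
case: (repr (mkfrac a s)) => a' s'; case: (repr (mkfrac x t)) => x' t' /= ex ea.
have {}ea : den u * den s * a' = den u * den s' * a by [].
apply/mkfracP; exists (denomM u v); rewrite /= ?denM; rewrite !scalerA.
transitivity ((den u * den s * a') *: ((den v * den t) *: x')).
  by rewrite scalerA; congr (_ *: _); rewrite ?denM ?den1; ring.
by rewrite ex ea scalerA; congr (_ *: _); rewrite ?denM ?den1; ring.
Qed.

Fact loc_addA : associative loc_add.
Proof.
elim/mkfrac_ind => x s; elim/mkfrac_ind => y t; elim/mkfrac_ind => z v.
rewrite !loc_addE; apply: mkfrac_eq; congr (_ *: _) => /=; first by rewrite ?denM; ring.
by rewrite !scalerDr !scalerA !addrA; do ?congr (_ + _); congr (_ *: _); rewrite ?denM ?den1; ring.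
Qed.

Fact loc_addC : commutative loc_add.
Proof.
elim/mkfrac_ind => x s; elim/mkfrac_ind => y t.
by rewrite !loc_addE addrC; apply: mkfrac_eq; congr (_ *: _) => /=; rewrite ?denM ?den1; ring.
Qed.

Fact loc_add0 : left_id loc_zero loc_add.
Proof.
elim/mkfrac_ind => x s; rewrite loc_addE scaler0 add0r scale1r.
by apply: mkfrac_eq; congr (_ *: _) => /=; rewrite ?denM ?den1; ring.
Qed.

Fact loc_addN : left_inverse loc_zero loc_opp loc_add.
Proof.
elim/mkfrac_ind => x s; rewrite loc_oppE loc_addE scalerN addNr.
by apply: mkfrac_eq; rewrite !scaler0.
Qed.

HB.instance Definition _ :=
  GRing.isZmodule.Build Mp loc_addA loc_addC loc_add0 loc_addN.

End LocalizedStructure.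

Section LocalizedRing.
Variables (R : comNzRingType) (p : prime_idealr R).

Definition locring := locmod p R^o.
HB.instance Definition _ := GRing.Zmodule.on locring.

Let one : locring := mkfrac (1 : R^o) (denom1 p).
Let mul : locring -> locring -> locring := @loc_scale R p R^o.

Fact locring_mulA : associative mul.
Proof.
elim/mkfrac_ind => a s; elim/mkfrac_ind => b t; elim/mkfrac_ind => c v.
rewrite /mul (loc_scaleE b t c v) (loc_scaleE a s b t) !loc_scaleE scalerA.
by apply: mkfrac_eq; congr (_ *: _) => /=; rewrite ?denM ?den1; ring.
Qed.

Fact locring_mulC : commutative mul.
Proof.
elim/mkfrac_ind => a s; elim/mkfrac_ind => b t; rewrite /mul !loc_scaleE.
by apply: mkfrac_eq; rewrite /GRing.scale /=; rewrite ?denM ?den1; ring.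
Qed.

Fact locring_mul1 : left_id one mul.
Proof.
elim/mkfrac_ind => a s; rewrite /mul !loc_scaleE scale1r.
by apply: mkfrac_eq; congr (_ *: _) => /=; rewrite ?denM ?den1; ring.
Qed.

Fact locring_mulD : left_distributive mul +%R.
Proof.
elim/mkfrac_ind => a s; elim/mkfrac_ind => b t; elim/mkfrac_ind => c v.
rewrite /mul [mkfrac a s + _]loc_addE (loc_scaleE a s c v) (loc_scaleE b t c v).
rewrite loc_scaleE [RHS]loc_addE.
by apply: mkfrac_eq; rewrite /GRing.scale /=; rewrite ?denM ?den1; ring.
Qed.

Fact locring_1neq0 : one != 0.
Proof.
apply/eqP => /mkfracP[u] /=; rewrite /GRing.scale /= !mulr1 mulr0 => u0.
by have := denP u; rewrite u0 idealr0.
Qed.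

HB.instance Definition _ := GRing.Zmodule_isComNzRing.Build locring
  locring_mulA locring_mulC locring_mul1 locring_mulD locring_1neq0.

Lemma mulfracE (a : R^o) (s : denom p) (b : R^o) t :
  (mkfrac a s : locring) * mkfrac b t = mkfrac ((a : R) * b : R^o) (denomM s t).
Proof. exact: loc_scaleE. Qed.

Variable M : lmodType R.
Let scale : locring -> locmod p M -> locmod p M := @loc_scale R p M.

Fact locmod_scaleA (a b : locring) z : scale a (scale b z) = scale (a * b) z.
Proof.
elim/mkfrac_ind: a => a s; elim/mkfrac_ind: b => b t; elim/mkfrac_ind: z => x v.
rewrite /scale (loc_scaleE b t x v) mulfracE.
rewrite !loc_scaleE scalerA.
by apply: mkfrac_eq; congr (_ *: _) => /=; rewrite ?denM ?den1; ring.
Qed.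

Fact locmod_scale1 : left_id 1 scale.
Proof.
elim/mkfrac_ind => x v; rewrite /scale loc_scaleE scale1r.
by apply: mkfrac_eq; congr (_ *: _) => /=; rewrite ?denM ?den1; ring.
Qed.

Fact locmod_scaleDr : right_distributive scale +%R.
Proof.
elim/mkfrac_ind => a s; elim/mkfrac_ind => x t; elim/mkfrac_ind => y v.
rewrite /scale [mkfrac x t + _]loc_addE (loc_scaleE a s x t) (loc_scaleE a s y v).
rewrite loc_scaleE [RHS]loc_addE.
apply: mkfrac_eq; rewrite !scalerDr !scalerA /=.
by congr (_ + _); congr (_ *: _); rewrite ?denM ?den1; ring.
Qed.

Fact locmod_scaleDl z : {morph scale^~ z : a b / a + b}.
Proof.
elim/mkfrac_ind: z => x v; elim/mkfrac_ind => a s; elim/mkfrac_ind => b t.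
rewrite /scale [mkfrac a s + _]loc_addE (loc_scaleE a s x v) (loc_scaleE b t x v).
rewrite loc_scaleE [RHS]loc_addE.
apply: mkfrac_eq; rewrite !scalerDr scalerDl !scalerDr !scalerA /=.
by rewrite /GRing.scale /=; congr (_ + _); congr (_ *: _); rewrite ?denM ?den1; ring.
Qed.

HB.instance Definition _ := GRing.Zmodule_isLmodule.Build locring (locmod p M)
  locmod_scaleA locmod_scale1 locmod_scaleDr locmod_scaleDl.

Lemma addfracE (x : M) (s : denom p) y t :
  mkfrac x s + mkfrac y t = mkfrac (den t *: x + den s *: y) (denomM s t).
Proof. exact: loc_addE. Qed.

Lemma scalefracE (a : R^o) (s : denom p) (x : M) t :
  (mkfrac a s : locring) *: mkfrac x t = mkfrac ((a : R) *: x) (denomM s t).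
Proof. exact: loc_scaleE. Qed.

End LocalizedRing.

Definition Supp (R : comNzRingType) (M : lmodType R)
    (p : prime_idealr R) : Prop :=
  exists z : locmod p M, z != 0.

(* Main.v *)
Require Import Defs.
From HB Require Import structures.
From mathcomp Require Import all_boot all_order all_algebra.
From mathcomp Require Import ring_quotient boolp classical_sets constructive_ereal.
From mathcomp Require Import ring.
Import GRing.Theory.
Local Open Scope ring_scope.

(** Write [Z] for the center of the endomorphism ring of [M] and [iota : R -> Z]
    for the natural map. If [iota] is bijective, then [Z] is [R] and all the other
    conditions follow, the last one because the formation of [Z] commutes with
    localization ([loc_center], [loc_center_num]; this rests on [M] and its
    endomorphism ring being finitely presented). The work is to recover the
    bijectivity of [iota] from freeness, from projectivity, and from the
    condition in depth at most one.

    The source of all three is a statement about socles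
    ([center_socle_scalar]). If [x] spans a simple submodule of a local ring [A], and
    [N] is an [A]-module with [x N <> 0], then [x N] is a vector space over the
    residue field, and [N] has enough endomorphisms through [N -> x N] for a
    central [z] to act on [x N] by a single scalar [c]: [x z = c x] in the center.
    Applied to the localization at an associated prime [q = ann x] of [R], it
    gives for every [z] in [Z] some [s] outside [q] and some [a] in [R] with
    [x s z = x a] ([center_at_annihilator]).

    When [Z] is free, two basis elements would then be proportional up to
    elements regular on [R x], so [Z = R e], and [z e = a e] forces [z = a]
    ([free_center_homotheties], [free_center_bij]).

    When [Z] is projective with dual basis [(z_i, f_i)], the relation
    [x (s z - a) = 0] puts all [f_i (s z - a)] in [q], hence [s z - a] in [q Z];
    by Nakayama's lemma [Z] equals [R] locally at every associated prime, which
    is enough for [f v w = f w v] to hold for all functionals [f] and all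
    [v, w] in [Z], and then [v = sum_i f_i (v z_i)] is a scalar
    ([projective_center_bij]).

    In the last case, [iota] is injective because it is so at the associated
    primes of [R], which have depth zero and belong to the support of [M]. If it
    were not surjective, an associated prime [p] of its cokernel would have depth
    at most one, since elements of [Z] cannot be torsion for the regular elements
    of [R] ([depth_conductor]); so the center at [p] is free. Its rank can be
    measured at an associated prime of [R] below [p], where it is one
    ([loc_homotheties_depth1]). Thus the cokernel vanishes at [p], which is a
    contradiction ([depth1_center_bij]). *)

Set Implicit Arguments.
Unset Strict Implicit.
Unset Printing Implicit Defensive.

(** * Submodules, linear maps and noetherian modules *)

Section Submodules.
Variable R : comNzRingType.
Implicit Types (V W : lmodType R) (a : R).

Definition submodule V (L : V -> Prop) : Prop :=
  L 0 /\ forall a u v, L u -> L v -> L (a *: u + v).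

Lemma submodule0 V (L : V -> Prop) : submodule L -> L 0.
Proof. by case. Qed.

Lemma submoduleZ V (L : V -> Prop) a u : submodule L -> L u -> L (a *: u).
Proof. by move=> [L0 Ll] Lu; rewrite -[_ *: _]addr0; apply: Ll. Qed.

Lemma submoduleD V (L : V -> Prop) u v : submodule L -> L u -> L v -> L (u + v).
Proof. by move=> [L0 Ll] Lu Lv; rewrite -[u]scale1r; apply: Ll. Qed.

Lemma submoduleB V (L : V -> Prop) u v : submodule L -> L u -> L v -> L (u - v).
Proof.
by move=> sL Lu Lv; apply: submoduleD => //; rewrite -scaleN1r; apply: submoduleZ.
Qed.

Lemma submodule_zero V : submodule (fun v : V => v = 0).
Proof. by split=> // a u v -> ->; rewrite scaler0 addr0. Qed.

Lemma in_span_nil V (x : V) : in_span [::] x <-> x = 0.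
Proof.
split=> [[c ->]|->]; first by rewrite big_ord0.
by exists (fun=> 0); rewrite big_ord0.
Qed.

Lemma in_span_cons V (y : V) s x :
  in_span (y :: s) x <-> exists a w, in_span s w /\ x = a *: y + w.
Proof.
split=> [[c ->]|[a [w [[c ->] ->]]]].
  rewrite big_ord_recl; exists (c ord0), (\sum_(i < size s) c (lift ord0 i) *: s`_i).
  by split=> //; exists (fun i => c (lift ord0 i)).
exists (fun i => oapp c a (unlift ord0 i)).
rewrite big_ord_recl unlift_none; congr (_ + _); apply: eq_bigr => i _.
by rewrite liftK.
Qed.

Lemma in_span_submodule V (s : seq V) : submodule (in_span s).
Proof.
split=> [|a u v [c ->] [d ->]].
  by exists (fun=> 0); rewrite big1 // => i _; rewrite scale0r.
exists (fun i => a * c i + d i); rewrite scaler_sumr -big_split /=.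
by apply: eq_bigr => i _; rewrite scalerDl scalerA.
Qed.

Lemma in_span_mem V (s : seq V) x : x \in s -> in_span s x.
Proof.
elim: s => // y s IH; rewrite inE => /predU1P[->|/IH xs]; apply/in_span_cons.
  by exists 1, 0; rewrite scale1r addr0; split=> //; have [] := in_span_submodule s.
by exists 0, x; rewrite scale0r add0r.
Qed.

Lemma in_span_sub V (L : V -> Prop) (s : seq V) :
  submodule L -> (forall v, v \in s -> L v) -> forall x, in_span s x -> L x.
Proof.
move=> sL; elim: s => [_ x /in_span_nil ->|y s IH Ls x]; first exact: submodule0.
case/in_span_cons => a [w [sw ->]]; apply: sL.2; first by apply: Ls; rewrite mem_head.
by apply: IH sw => v vs; apply: Ls; rewrite inE vs orbT.
Qed.

(** A linear relation that is total and single-valued at zero is the graph of a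
    linear map; this is how maps are defined out of quotients and of
    presentations. *)
Lemma graph_linear V W (G : V -> W -> Prop) :
  (forall v, exists w, G v w) ->
  (forall a u v x y, G u x -> G v y -> G (a *: u + v) (a *: x + y)) ->
  (forall w, G 0 w -> w = 0) ->
  exists h : {linear V -> W}, forall v, G v (h v).
Proof.
move=> Gt Gl G0; have [h hG] := choice Gt.
have hu v w : G v w -> h v = w.
  move=> Gvw; apply/eqP; rewrite -subr_eq0 addrC; apply/eqP/G0.
  have := Gl (-1) _ _ _ _ Gvw (hG v).
  by rewrite !scaleN1r addNr.
have hl : linear h by move=> a u v; apply: hu; apply: Gl.
pose hL := GRing.isLinear.Build R V W *:%R h hl.
pose H : {linear V -> W} := HB.pack h hL.
by exists H.
Qed.

Definition noetherian_module V : Prop :=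
  forall L : V -> Prop, submodule L -> exists s : seq V, forall x, L x <-> in_span s x.

Lemma noetherian_regular : noetherian R -> noetherian_module R^o.
Proof.
move=> hR L sL; have [|s Hs] := hR [pred x | `[< L x >]].
  by split=> [|a u v]; rewrite !inE; [case: sL | apply: sL.2].
by exists s => x; rewrite -Hs inE.
Qed.

(** Choose elements of [L] mapping to generators of its image under the first
    map, and add generators of the part of [L] that this map kills. *)
Lemma noetherian_joint (I : finType) V W (u : I -> {linear V -> W}) :
  noetherian_module W -> (forall v, (forall i, u i v = 0) -> v = 0) ->
  noetherian_module V.
Proof.
move=> nW uI.
suff H (l : seq I) (L : V -> Prop) : submodule L ->
    (forall v, L v -> (forall i, i \in l -> u i v = 0) -> v = 0) ->
    exists s : seq V, forall x, L x <-> in_span s x.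
  move=> L sL; apply: (H (enum I)) => // v _ uv.
  by apply: uI => i; apply: uv; rewrite mem_enum.
elim: l L => [|i l IH] L sL Ll.
  exists [::] => x; split=> [Lx|/in_span_nil ->]; last exact: submodule0.
  by apply/in_span_nil/(Ll x Lx).
have [s' Hs'] : exists s, forall x, (L x /\ u i x = 0) <-> in_span s x.
  apply: IH => [|v [Lv uv] lv].
    split=> [|a x y [Lx ux] [Ly uy]]; first by rewrite linear0; split=> //; case: sL.
    by split; [apply: sL.2 | rewrite linearP ux uy scaler0 addr0].
  by apply: Ll => // j; rewrite inE => /predU1P[->|/lv].
have [|t Ht] := nW (fun w => exists2 v, L v & u i v = w).
  split=> [|a x y [x' Lx <-] [y' Ly <-]]; first by exists 0; [case: sL | rewrite linear0].
  by exists (a *: x' + y'); [apply: sL.2 | rewrite linearP].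
have [t' [tt' Lt']] : exists t', t = map (u i) t' /\ forall v, v \in t' -> L v.
  have : forall w, w \in t -> exists2 v, L v & u i v = w.
    by move=> w /in_span_mem /Ht.
  elim: t {Ht} => [|w t IHt] tL; first by exists [::].
  have [v vt|t' [-> Lt']] := IHt; first by apply: tL; rewrite inE vt orbT.
  have [v Lv uv] := tL w (mem_head _ _).
  by exists (v :: t'); split=> [|x]; rewrite /= ?uv // inE => /predU1P[->|/Lt'].
have lift_span w : in_span t w -> exists2 v, in_span t' v & u i v = w.
  rewrite tt'; elim: (t') w => [|y r IHr] w /=.
    by move=> /in_span_nil ->; exists 0; [apply/in_span_nil | rewrite linear0].
  move=> /in_span_cons[a [w' [/IHr[v vr <-] ->]]].
  by exists (a *: y + v); [apply/in_span_cons; exists a, v | rewrite linearP].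
have span_cat (x y : V) : in_span t' x -> in_span s' y -> in_span (t' ++ s') (x + y).
  move=> xt ys; apply: submoduleD; first exact: in_span_submodule.
    apply: in_span_sub xt => [|v vt]; first exact: in_span_submodule.
    by apply: in_span_mem; rewrite mem_cat vt.
  apply: in_span_sub ys => [|v vt]; first exact: in_span_submodule.
  by apply: in_span_mem; rewrite mem_cat vt orbT.
exists (t' ++ s') => x; split=> [Lx|].
  have /Ht /lift_span[v vt uv] : exists2 v, L v & u i v = u i x by exists x.
  have Lv : L v by apply: in_span_sub vt.
  rewrite -[x](subrK v) addrC; apply: span_cat => //.
  by apply/Hs'; split; [apply: submoduleB | rewrite linearB uv subrr].
apply: in_span_sub => // v; rewrite mem_cat => /orP[/Lt' //|/in_span_mem /Hs'].
by case.
Qed.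

Lemma in_span_map V W (u : {linear V -> W}) (s : seq V) x :
  in_span s x -> in_span (map u s) (u x).
Proof.
move=> sx; apply: (in_span_sub (L := fun x => in_span (map u s) (u x))) sx.
  split=> [|a v w]; first by rewrite linear0; case: (in_span_submodule (map u s)).
  by rewrite linearP; apply: (in_span_submodule _).2.
by move=> v vs; apply/in_span_mem/map_f.
Qed.

Lemma noetherian_image V W (u : {linear V -> W}) :
  noetherian_module V -> (forall w, exists v, u v = w) -> noetherian_module W.
Proof.
move=> nV us L sL; have [|s Hs] := nV (fun v => L (u v)).
  by split=> [|a x y Lx Ly]; rewrite ?linear0 ?linearP; [case: sL | apply: sL.2].
exists (map u s) => w; split=> [|sw].
  by have [v <-] := us w; move=> /Hs /in_span_map.
by apply: (in_span_sub sL) sw => _ /mapP[v vs ->]; apply/Hs/in_span_mem.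
Qed.

Lemma row_coord_linear n (i : 'I_n) : linear (fun v : 'rV[R]_n => v ord0 i : R^o).
Proof. by move=> a u v; rewrite !mxE. Qed.

Definition row_coord n (i : 'I_n) : {linear 'rV[R]_n -> R^o} :=
  HB.pack (fun v : 'rV[R]_n => v ord0 i : R^o)
    (GRing.isLinear.Build R 'rV[R]_n R^o *:%R _ (row_coord_linear i)).

Lemma noetherian_rV n : noetherian R -> noetherian_module 'rV[R]_n.
Proof.
move=> hR; apply: (noetherian_joint (u := @row_coord n)); first exact: noetherian_regular.
by move=> v v0; apply/rowP => i; rewrite mxE; apply: v0.
Qed.

Lemma comb_linear V n (x : 'I_n -> V) :
  linear (fun c : 'rV[R]_n => \sum_(i < n) c ord0 i *: x i).
Proof.
move=> a u v; rewrite scaler_sumr -big_split /=; apply: eq_bigr => i _.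
by rewrite !mxE scalerDl scalerA.
Qed.

Definition comb V n (x : 'I_n -> V) : {linear 'rV[R]_n -> V} :=
  HB.pack (fun c : 'rV[R]_n => \sum_(i < n) c ord0 i *: x i)
    (GRing.isLinear.Build R 'rV[R]_n V *:%R _ (comb_linear x)).

Lemma combE V n (x : 'I_n -> V) c : comb x c = \sum_(i < n) c ord0 i *: x i.
Proof. by []. Qed.

Lemma fg_presented V : finitely_generated V ->
  exists n (x : 'I_n -> V), forall v, exists c, comb x c = v.
Proof.
move=> [s sV]; exists (size s), (fun i => s`_i) => v; have [c ->] := sV v.
by exists (\row_i c i); rewrite combE; apply: eq_bigr => i _; rewrite mxE.
Qed.

Lemma noetherian_fg V : noetherian R -> finitely_generated V -> noetherian_module V.
Proof.
move=> hR /fg_presented[n [x xs]].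
by apply: (noetherian_image (u := comb x)) => //; apply: noetherian_rV.
Qed.

Lemma fg_noetherian V : noetherian_module V -> finitely_generated V.
Proof. by move=> /(_ (fun=> True))[|s Hs]; [split|exists s => x; apply/Hs]. Qed.

End Submodules.

(** * Endomorphisms and the center as noetherian modules *)

Section Endos.
Variables (R : comNzRingType) (M : lmodType R).

Lemma ev_linear (x : M) : linear (fun f : End M => f x).
Proof. by []. Qed.

Definition ev (x : M) : {linear End M -> M} :=
  HB.pack (fun f : End M => f x)
    (GRing.isLinear.Build R (End M) M *:%R _ (ev_linear x)).

Lemma val_End_center_linear : linear (val : End_center M -> End M).
Proof. by []. Qed.

Definition val_linear : {linear End_center M -> End M} :=
  HB.pack (val : End_center M -> End M)
    (GRing.isLinear.Build R (End_center M) (End M) *:%R _ val_End_center_linear).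

Lemma noetherian_End : noetherian R -> finitely_generated M ->
  noetherian_module (End M).
Proof.
move=> hR fM; have nM := noetherian_fg hR fM.
have [n [x xs]] := fg_presented fM.
apply: (noetherian_joint (u := fun i => ev (x i))) => // f f0.
apply: End_ext => m; have [c <-] := xs m; rewrite combE linear_sum big1 // => i _.
by rewrite linearZ /= (f0 i : f (x i) = 0) scaler0.
Qed.

Lemma noetherian_center : noetherian R -> finitely_generated M ->
  noetherian_module (End_center M).
Proof.
move=> hR fM; apply: (noetherian_joint (u := fun _ : unit => val_linear)).
  exact: noetherian_End.
by move=> v /(_ tt) v0; apply: val_inj.
Qed.

End Endos.

(** * Primes, maximal submodules and Nakayama's lemma *)

Section Ideals.
Variable R : comNzRingType.
Implicit Types (V : lmodType R) (p q : prime_idealr R).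

Lemma prime_of_pred (P : R -> Prop) :
  P 0 -> ~ P 1 -> (forall a u v, P u -> P v -> P (a * u + v)) ->
  (forall u v, P (u * v) -> P u \/ P v) ->
  exists q : prime_idealr R, forall a, a \in q <-> P a.
Proof.
move=> P0 P1 Pl Pp; pose S (a : R) : bool := `[< P a >].
have id_S : idealr_closed S.
  split=> [||a u v /asboolP Pu /asboolP Pv]; first exact: asboolT.
    by apply/negP => /asboolP.
  exact/asboolT/Pl.
have pr_S : prime_idealr_closed S.
  by move=> u v /asboolP /Pp[Pu|Pv]; apply/orP; [left|right]; exact: asboolT.
pose hI := isIdealr.Build R S id_S.
pose hP := isPrimeIdealrClosed.Build R S pr_S.
pose q : prime_idealr R := HB.pack S hI hP.
by exists q => a; split=> [/asboolP|Pa]; last exact/asboolP.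
Qed.

(** An ideal of the form [(L : b x)] that is maximal among those avoiding [S] is
    prime. With [L = 0] this produces associated primes. *)
Lemma exists_prime_colon V (L : V -> Prop) (S : R -> Prop) (x : V) :
  noetherian R -> submodule L ->
  S 1 -> (forall s t, S s -> S t -> S (s * t)) ->
  (forall s, S s -> ~ L (s *: x)) ->
  exists (b : R) (q : prime_idealr R),
    (forall a, a \in q <-> L ((a * b) *: x)) /\ (forall s, S s -> s \notin q).
Proof.
move=> hR sL S1 SM Sx.
pose good (b : R) := forall s, S s -> ~ L ((s * b) *: x).
pose T := {b : R | good b}.
have good1 : good 1 by move=> s Ss; rewrite mulr1; exact: Sx.
pose le (b c : T) := `[< forall a, L ((a * sval b) *: x) -> L ((a * sval c) *: x) >].
have lexx b : le b b by apply/asboolP.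
have le_trans b c d : le b c -> le c d -> le b d.
  by move=> /asboolP bc /asboolP cd; apply/asboolP => a /bc /cd.
have ub (A : set T) : total_on A le -> exists t, forall s, A s -> le s t.
  move=> tA; have [[t0 At0]|A0] := pselect (exists t, A t); last first.
    by exists (exist good 1 good1) => s As; case: A0; exists s.
  pose U (a : R^o) := exists2 t, A t & L (((a : R) * sval t) *: x).
  have sU : submodule U.
    split=> [|a u v [t At Lt] [r Ar Lr]].
      by exists t0; rewrite // mul0r scale0r; case: sL.
    wlog le_tr : a u v t r At Lt Ar Lr / le t r => [W|].
      have [tr|/asboolP rt] := tA _ _ At Ar; first exact: (W _ _ _ t r).
      exists t => //; rewrite mulrDl scalerDl -mulrA -scalerA.
      by apply: sL.2 => //; apply: rt.
    exists r => //; rewrite mulrDl scalerDl -mulrA -scalerA; apply: sL.2 => //.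
    by move/asboolP: le_tr; apply.
  have [s Hs] := noetherian_regular hR sU.
  have [t At Ht] : exists2 t, A t & forall v, v \in s -> L ((v * sval t) *: x).
    have : forall v, v \in s -> U v by move=> v /in_span_mem /Hs.
    elim: (s) => [|w r IH] Ur; first by exists t0.
    have [v vr|t At Ht] := IH; first by apply: Ur; rewrite inE vr orbT.
    have [t' At' Ht'] := Ur w (mem_head _ _).
    have [/asboolP tt'|/asboolP t't] := tA _ _ At At'.
      by exists t' => // v; rewrite inE => /predU1P[->//|/Ht /tt'].
    by exists t => // v; rewrite inE => /predU1P[->|/Ht //]; apply: t't.
  exists t => t' At'; apply/asboolP => a La.
  have /Hs : U a by exists t'.
  apply: (in_span_sub (L := fun v : R^o => L (((v : R) * sval t) *: x))) => //.
  split=> [|c u v Lu Lv]; first by rewrite mul0r scale0r; case: sL.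
  by rewrite mulrDl scalerDl -mulrA -scalerA; apply: sL.2.
have [[b gb] bmax] := ZL_preorder (exist good 1 good1) lexx le_trans ub.
have maxb c : good (c * b) -> forall a, L ((a * (c * b)) *: x) -> L ((a * b) *: x).
  move=> gc a; have /asboolP : le (exist good _ gc) (exist good _ gb).
    apply: bmax; apply/asboolP => d Ld /=.
    by rewrite mulrCA -scalerA; apply: submoduleZ.
  exact.
have [||||q qP] := @prime_of_pred (fun a => L ((a * b) *: x)).
- by rewrite mul0r scale0r; case: sL.
- exact: (gb _ S1).
- by move=> a u v Lu Lv; rewrite mulrDl scalerDl -mulrA -scalerA; apply: sL.2.
- move=> u v Luv; have [Lv|nLv] := pselect (L ((v * b) *: x)); [by right|left].
  have [gvb|/existsNP[s /not_implyP[Ss /contrapT Lsv]]] := pselect (good (v * b)).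
    by apply: (maxb _ gvb); rewrite mulrA.
  case: nLv; apply: (maxb s); last by rewrite mulrA (mulrC v) -mulrA.
  by move=> t St; rewrite mulrA; apply: (gb (t * s)); apply: SM.
by exists b, q; split=> // s Ss; apply/negP => /qP; apply: (gb s).
Qed.

(** A submodule maximal among those containing [L0] and avoiding [n]. *)
Lemma exists_maximal_avoiding V (L0 : V -> Prop) (n : V) :
  submodule L0 -> ~ L0 n ->
  exists L : V -> Prop, [/\ submodule L, forall v, L0 v -> L v, ~ L n &
    forall y, ~ L y -> exists b, L (n - b *: y)].
Proof.
move=> sL0 nL0.
(* The empty chain has the empty set as its union, hence the union with [L0]. *)
pose P (A : set V) := ~ A n /\ submodule (fun v => A v \/ L0 v).
have [F FP totF|A [[nA sA] maxA]] := @Zorn_bigcup V P.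
  split=> [[X FX Xn]|]; first by case: (FP _ FX).
  split=> [|a u v]; first by right; case: sL0.
  have sX X : F X -> submodule (fun v => X v \/ L0 v) by move=> /FP[].
  case=> [[X FX Xu]|Lu]; case=> [[Y FY Yv]|Lv].
  - have [XY|YX] := totF _ _ FX FY.
      have [Z|Z] := (sX _ FY).2 a u v (or_introl (XY _ Xu)) (or_introl Yv).
        by left; exists Y.
      by right.
    have [Z|Z] := (sX _ FX).2 a u v (or_introl Xu) (or_introl (YX _ Yv)).
      by left; exists X.
    by right.
  - have [Z|Z] := (sX _ FX).2 a u v (or_introl Xu) (or_intror Lv).
      by left; exists X.
    by right.
  - have [Z|Z] := (sX _ FY).2 a u v (or_intror Lu) (or_introl Yv).
      by left; exists Y.
    by right.
  - by right; apply: sL0.2.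
exists (fun v => A v \/ L0 v); split=> // [v|[]//|y nLy]; first by right.
pose B : set V := fun v => exists b, A (v - b *: y) \/ L0 (v - b *: y).
have sB : submodule B.
  split=> [|a u v [b Bu] [c Cv]]; first by exists 0; rewrite scale0r subr0; right; case: sL0.
  exists (a * b + c); have := sA.2 a _ _ Bu Cv; congr (A _ \/ L0 _);
    by rewrite scalerBr scalerDl scalerA opprD addrACA.
have AB v : A v \/ L0 v -> B v by exists 0; rewrite scale0r subr0.
have yB : B y by exists 1; rewrite scale1r subrr; exact: submodule0 sA.
apply: contrapT => nB; apply: (maxA B).
  split=> [v Av|/(_ y yB) Ay]; first by apply: AB; left.
  by apply: nLy; left.
split=> [[b Bb]|]; first by apply: nB; exists b.
split=> [|a u v]; first by left; exact: submodule0 sB.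
move=> Bu Bv; left; apply: sB.2.
  by case: Bu => // Lu; apply: AB; right.
by case: Bv => // Lv; apply: AB; right.
Qed.

Lemma notin_primeM p s t : s \notin p -> t \notin p -> s * t \notin p.
Proof. by move=> sp tp; rewrite prime_idealrM negb_or sp tp. Qed.

Lemma notin_prime1 p : 1 \notin p. Proof. by rewrite idealr1. Qed.

Lemma common_multiple p (I : finType) (Q : R -> I -> Prop) :
  (forall s t i, Q s i -> Q (t * s) i) ->
  (forall i, exists2 s, s \notin p & Q s i) ->
  exists2 s, s \notin p & forall i, Q s i.
Proof.
move=> QM Qi; suff [s sp Qs] : exists2 s, s \notin p & forall i, i \in enum I -> Q s i.
  by exists s => // i; apply: Qs; rewrite mem_enum.
elim: (enum I) => [|i l [s sp IH]]; first by exists 1; rewrite ?notin_prime1.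
have [t tp Qt] := Qi i; exists (s * t); first exact: notin_primeM.
by move=> j; rewrite inE => /predU1P[->|/IH Qs]; [|rewrite mulrC]; apply: QM.
Qed.

Lemma fg_uniform_denominator p V (L : V -> Prop) :
  finitely_generated V -> submodule L ->
  (forall v, exists2 s, s \notin p & L (s *: v)) ->
  exists2 s, s \notin p & forall v, L (s *: v).
Proof.
move=> /fg_presented[n [x xV]] sL Lv.
have [s t i Qi|i|s sp Qs] := @common_multiple p 'I_n (fun s i => L (s *: x i)).
- by rewrite -scalerA; apply: submoduleZ.
- exact: Lv.
exists s => // v; have [c <-] := xV v; rewrite combE scaler_sumr.
elim/big_rec: _ => [|i w _ Lw]; first by case: sL.
by rewrite scalerA mulrC -scalerA; apply: sL.2.
Qed.

Definition in_ideal_mul p V (v : V) : Prop :=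
  exists n (c : 'I_n -> R) (y : 'I_n -> V),
    (forall i, c i \in p) /\ v = \sum_(i < n) c i *: y i.

(** Nakayama's lemma for [V / L] localized at [p]. Generators are discarded one at
    a time: if [y] is congruent to a combination of vectors with coefficients in
    [p], and these vectors are multiples of [y] up to the denominator [r], then
    the resulting relation [d y = 0] has its coefficient [d] outside [p]. *)
Lemma nakayama p V (L : V -> Prop) :
  finitely_generated V -> submodule L ->
  (forall v, exists s, s \notin p /\ exists2 m, in_ideal_mul p m & L (s *: v - m)) ->
  exists2 s, s \notin p & forall v, L (s *: v).
Proof.
move=> [ys ysV] sL Lp.
have : exists2 s, s \notin p & forall v, exists2 w, in_span ys w & L (s *: v - w).
  exists 1; first exact: notin_prime1.
  by move=> v; exists v => //; rewrite scale1r subrr; case: sL.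
(* The next generator [y] is first put into the submodule, [L' = L + R y], so that
   the induction hypothesis takes care of the other generators. *)
elim: ys {ysV} L sL Lp => [|y ys IH] L sL Lp [s sp Ls].
  exists s => // v; have [w /in_span_nil -> ] := Ls v; by rewrite subr0.
pose L' v := exists a, L (v - a *: y).
have LL' v : L v -> L' v by exists 0; rewrite scale0r subr0.
have sL' : submodule L'.
  split=> [|a u v [b Lb] [c Lc]]; first by apply: LL'; case: sL.
  exists (a * b + c); have := sL.2 a _ _ Lb Lc; congr (L _).
  by rewrite scalerBr scalerDl scalerA opprD addrACA.
have [v||r rp Lr] := IH L' sL'.
- by have [t [tp [m pm Lm]]] := Lp v; exists t; split=> //; exists m => //; apply: LL'.
- exists s => // v; have [w /in_span_cons[a [w' [sw' ->]]] Lw] := Ls v.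
  by exists w' => //; exists a; rewrite -addrA -opprD (addrC w').
have [t [tp [m [n [c [z [cp mE]]]] Lm]]] := Lp y.
have [a La] := choice (fun i => Lr (z i)).
pose e := \sum_(i < n) c i * a i.
have ep : e \in p.
  by rewrite /e rpred_sum // => i _; rewrite mulrC idealMr.
have dp : r * t - e \notin p.
  apply: contra (notin_primeM rp tp) => h.
  by rewrite -[_ * _](subrK e); apply: rpredD.
have Ly : L ((r * t - e) *: y).
  have -> : (r * t - e) *: y = r *: (t *: y - m) + (r *: m - e *: y).
    by rewrite scalerBr scalerBl scalerA addrA subrK.
  apply: sL.2 => //; rewrite mE scaler_sumr /e scaler_suml -sumrB.
  elim/big_rec: _ => [|i w _ Lw]; first by case: sL.
  have -> : r *: (c i *: z i) - (c i * a i) *: y = c i *: (r *: z i - a i *: y).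
    by rewrite scalerBr !scalerA mulrC.
  exact: sL.2.
exists ((r * t - e) * r); first exact: notin_primeM.
move=> v; have [b Lb] := Lr v.
have -> : ((r * t - e) * r) *: v =
    (r * t - e) *: (r *: v - b *: y) + b *: ((r * t - e) *: y).
  by rewrite scalerBr !scalerA (mulrC b) subrK.
by apply: sL.2 => //; apply: submoduleZ.
Qed.

End Ideals.

(** * The natural maps to a localization *)

Section Localization.
Variables (R : comNzRingType) (p : prime_idealr R).
Implicit Types (M N : lmodType R).

(** [fr] is the natural map [x |-> x / 1] from [M] to its localization, and [sc]
    the same map on [R], seen as scalars. Localized modules are handled
    through these two maps, by clearing denominators. *)
Definition fr M (x : M) : locmod p M := mkfrac x (denom1 p).
Definition sc (a : R) : locring p := mkfrac (a : R^o) (denom1 p).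

Lemma fr_linear M a (x y : M) : fr (a *: x + y) = sc a *: fr x + fr y.
Proof.
rewrite /fr /sc scalefracE addfracE; apply: mkfrac_eq.
by rewrite !denM den1 !mul1r !scale1r.
Qed.

Lemma fr0 M : fr (0 : M) = 0. Proof. by []. Qed.

Lemma frZ M a (x : M) : fr (a *: x) = sc a *: fr x.
Proof. by rewrite -[a *: x]addr0 fr_linear fr0 addr0. Qed.

Lemma sc1 : sc 1 = 1. Proof. by []. Qed.

Lemma frD M (x y : M) : fr (x + y) = fr x + fr y.
Proof. by rewrite -[x]scale1r fr_linear sc1 !scale1r. Qed.

Lemma frB M (x y : M) : fr (x - y) = fr x - fr y.
Proof. by apply/eqP; rewrite eq_sym subr_eq -frD subrK. Qed.

Lemma fr_sum M n (c : 'I_n -> R) (x : 'I_n -> M) :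
  fr (\sum_(i < n) c i *: x i) = \sum_(i < n) sc (c i) *: fr (x i).
Proof.
elim/big_rec2: _ => [//|i w z _ <-]; exact: fr_linear.
Qed.

Lemma scM a b : sc (a * b) = sc a * sc b.
Proof. exact: (@frZ R^o). Qed.

Lemma fr_eq0 M (x : M) : fr x = 0 <-> exists2 s, s \notin p & s *: x = 0.
Proof.
rewrite -fr0 /fr mkfracP; split=> [[u]|[s sp sx]].
  by rewrite den1 !mulr1 scaler0 => ux; exists (den u) => //; apply: denP.
exists (exist _ s sp); rewrite den1 !mulr1 scaler0; exact: sx.
Qed.

Lemma sc_eq0 a : sc a = 0 <-> exists2 s, s \notin p & s * a = 0.
Proof. exact: (@fr_eq0 R^o). Qed.

Lemma sc_unit s : s \notin p -> exists u, u * sc s = 1.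
Proof.
move=> sp; exists (mkfrac (1 : R^o) (exist _ s sp)); rewrite mulfracE; apply: mkfrac_eq.
by rewrite den1 denM den1 mulr1 mul1r scale1r /GRing.scale /= mulr1.
Qed.

Lemma fr_num M (z : locmod p M) : exists s, s \notin p /\ exists x, sc s *: z = fr x.
Proof.
elim/mkfrac_ind: z => x s; exists (den s); split; first exact: denP.
exists x; rewrite scalefracE; apply: mkfrac_eq.
by rewrite denM den1 mul1r scale1r.
Qed.

Lemma sc_num (a : locring p) : exists s, s \notin p /\ exists b, sc s * a = sc b.
Proof. exact: (@fr_num R^o). Qed.

Lemma sc_inj M s (z w : locmod p M) : s \notin p -> sc s *: z = sc s *: w -> z = w.
Proof.
move=> /sc_unit[u us] /(congr1 ( *:%R u)).
by rewrite !scalerA us !scale1r.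
Qed.

Lemma frac_eqP M (g h : {linear locmod p M -> locmod p M}) :
  (forall x, g (fr x) = h (fr x)) -> forall z, g z = h z.
Proof.
move=> gh z; have [s [sp [x zx]]] := fr_num z.
by apply: (sc_inj sp); rewrite -!linearZ zx.
Qed.

Lemma loc_map M (g : End M) :
  exists gp : End (locmod p M), forall x, gp (fr x) = fr (g x).
Proof.
pose G (z w : locmod p M) := exists s, s \notin p /\
  exists2 x, sc s *: z = fr x & sc s *: w = fr (g x).
have [z|a u v y w|w|gp gpG] := @graph_linear _ _ _ G.
- have [s [sp [x zx]]] := fr_num z; have [t ts] := sc_unit sp.
  exists (t *: fr (g x)), s; split=> //; exists x => //.
  by rewrite scalerA mulrC ts scale1r.
- move=> [s [sp [x1 ux yx]]] [t [tp [x2 vx wx]]].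
  have [r [rp [b ab]]] := sc_num a.
  have E (z z' : locmod p M) : sc (r * (s * t)) *: (a *: z + z') =
      sc (t * b) *: (sc s *: z) + sc (r * s) *: (sc t *: z').
    rewrite scalerDr !scalerA !scM -ab.
    by congr (_ *: _ + _ *: _); ring.
  exists (r * (s * t)); split; first by rewrite !notin_primeM.
  exists ((t * b) *: x1 + (r * s) *: x2).
    by rewrite E ux vx frD !frZ.
  by rewrite E yx wx linearD !linearZ frD !frZ.
- move=> [s [sp [x]]]; rewrite scaler0 => /esym /fr_eq0[t tp tx] wx.
  apply: (sc_inj sp); rewrite wx scaler0; apply/fr_eq0; exists t => //.
  by rewrite -linearZ tx linear0.
exists gp => x; have [s [sp [y xy wy]]] := gpG (fr x).
apply: (sc_inj sp); rewrite wy -frZ; apply/eqP; rewrite -subr_eq0 -frB; apply/eqP/fr_eq0.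
have /fr_eq0[t tp tx] : fr (y - s *: x) = 0 by rewrite frB -xy frZ subrr.
exists t => //; rewrite -linearZ -linearB -linearZ.
by rewrite -(linear0 g) -tx.
Qed.

End Localization.

Arguments fr {R p M}.
Arguments sc {R p}.

(** * Localization of endomorphisms and of the center *)

Section LocalizedEndomorphisms.
Variables (R : comNzRingType) (p : prime_idealr R) (M : lmodType R).
Hypotheses (hR : noetherian R) (hM : finitely_generated M).

(** Lift the images of the generators of [M] with a common denominator [s]. The
    finitely many relations among the generators hold for these lifts after
    multiplication by some [t], so [t s g] comes from an endomorphism of [M]. *)
Lemma loc_End_num (g : End (locmod p M)) :
  exists (h : End M) s, s \notin p /\ forall m, sc s *: g (fr m) = fr (h m).
Proof.
have [n [x xM]] := fg_presented hM.
have [s t i [y sy]|i|s sp /choice[y sy]] := @common_multiple R p 'I_n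
    (fun s i => exists y, sc s *: g (fr (x i)) = fr y).
- by exists (t *: y); rewrite scM -scalerA sy frZ.
- by have [s [sp [y sy]]] := fr_num (g (fr (x i))); exists s => //; exists y.
have gE c : sc s *: g (fr (comb x c)) = fr (comb y c).
  rewrite !combE !fr_sum linear_sum scaler_sumr; apply: eq_bigr => i _.
  by rewrite linearZ /= scalerA mulrC -scalerA sy.
have [|ks Hks] := noetherian_rV (n := n) hR (L := fun c => comb x c = 0).
  split=> [|a u v ux vx]; first exact: linear0.
  by rewrite linearP ux vx scaler0 addr0.
have [t r i|i|t tp Ht] := @common_multiple R p 'I_(size ks)
    (fun t i => t *: comb y ks`_i = 0).
- by rewrite -scalerA => ->; rewrite scaler0.
- have xk : comb x ks`_i = 0 by apply/Hks/in_span_mem/mem_nth.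
  have : fr (p := p) (comb y ks`_i) = 0 by rewrite -gE xk fr0 linear0 scaler0.
  by move=> /fr_eq0.
have ker_t c : comb x c = 0 -> t *: comb y c = 0.
  move=> /Hks; apply: (in_span_sub (L := fun c => t *: comb y c = 0)).
    split=> [|a u v ux vx]; first by rewrite linear0 scaler0.
    by rewrite linearP scalerDr scalerA mulrC -scalerA ux vx scaler0 addr0.
  by move=> v /(nthP 0)[j jk <-]; apply: (Ht (Ordinal jk)).
have [m|a u v w z [c <- ->] [d <- ->]|w [c c0 ->]|h hG] :=
    graph_linear (G := fun m w => exists2 c, comb x c = m & w = t *: comb y c).
- by have [c cm] := xM m; exists (t *: comb y c), c.
- exists (a *: c + d); first by rewrite linearP.
  by rewrite linearP scalerDr !scalerA mulrC.
- exact: ker_t.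
exists h, (t * s); split; first exact: notin_primeM.
by move=> m; have [c <- ->] := hG m; rewrite scM -scalerA gE frZ.
Qed.

(** A numerator [h] of [z] commutes with every endomorphism of [M] up to a
    denominator, which can be chosen uniformly because the endomorphism ring is a
    finitely generated module. *)
Lemma loc_center_num (z : End_center (locmod p M)) :
  exists (w : End_center M) s, s \notin p /\
    forall m, sc s *: val z (fr m) = fr (val w m).
Proof.
have [h [s [sp hz]]] := loc_End_num (val z).
have comm_at (g : End M) m : exists2 t, t \notin p & t *: (h (g m) - g (h m)) = 0.
  apply/fr_eq0; have [gp gpE] := loc_map p g.
  have /(congr1 (fun f : End (locmod p M) => f (fr m))) := centralP _ (valP z) gp.
  rewrite !End_mulE gpE => /(congr1 ( *:%R (sc s))).
  have gpZ v : sc s *: gp v = gp (sc s *: v) by rewrite linearZ.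
  by rewrite hz gpZ hz gpE frB => ->; apply: subrr.
have comm (g : End M) : exists2 t, t \notin p & h * (t *: g) = (t *: g) * h.
  have [|m|t tp tg] := fg_uniform_denominator (p := p)
      (L := fun m => h (g m) - g (h m) = 0) hM.
  - split=> [|a u v hu hv]; first by rewrite (linear0 g) (linear0 h) (linear0 g) subrr.
    by rewrite (linearP g) !(linearP h) (linearP g) opprD addrACA -scalerBr hu hv scaler0 addr0.
  - have [t tp tm] := comm_at g m; exists t => //.
    by rewrite (linearZ_LR g) !(linearZ_LR h) (linearZ_LR g) -scalerBr tm.
  exists t => //; apply: End_ext => m; apply/eqP; rewrite -subr_eq0; apply/eqP.
  change (h (t *: g m) - t *: g (h m) = 0); rewrite -[RHS](tg m).
  by rewrite (linearZ_LR g) !(linearZ_LR h) (linearZ_LR g).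
have [|//|t tp th] := fg_uniform_denominator (p := p)
    (L := fun g : End M => h * g = g * h) (fg_noetherian (noetherian_End hR hM)).
  split=> [|a u v hu hv]; first by rewrite mulr0 mul0r.
  apply: End_ext => m; have /(congr1 (fun f : End M => f m)) := hu.
  have /(congr1 (fun f : End M => f m)) := hv.
  rewrite !End_mulE !End_addE !End_scaleE => hv' hu'.
  by rewrite linearD linearZ /= hu' hv'.
have cth : (t *: h : End M) \in @central R M.
  apply/centralP => g; apply: End_ext => m.
  have thm : h (t *: g m) = t *: g (h m) := congr1 (fun f : End M => f m) (th g).
  change (t *: h (g m) = g (t *: h m)).
  by rewrite (linearZ_LR g) -thm (linearZ_LR h).
exists (exist _ (t *: h) cth), (t * s); split; first exact: notin_primeM.
by move=> m; rewrite scM -scalerA hz -frZ.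
Qed.

(** A central endomorphism of [M] stays central in the localization, since all
    endomorphisms there are fractions of endomorphisms of [M]. *)
Lemma loc_center (w : End_center M) :
  exists z : End_center (locmod p M), forall m, val z (fr m) = fr (val w m).
Proof.
have [z zE] := loc_map p (val w).
have cz : z \in @central _ (locmod p M).
  apply/centralP => g; apply: End_ext; apply: frac_eqP => m.
  have [h [s [sp hg]]] := loc_End_num g.
  apply: (sc_inj sp); rewrite !End_mulE zE hg.
  have zZ v : sc s *: z v = z (sc s *: v) by rewrite linearZ.
  rewrite zZ hg zE.
  by have /(congr1 (fun f : End M => f m)) := centralP _ (valP w) h; rewrite !End_mulE => ->.
by exists (exist _ z cz).
Qed.

(** One denominator serves for all of [M], which is finitely generated. *)
Lemma loc_homothety (w : End_center M) (x : R) (c : locring p) :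
  (forall m, sc x *: fr (val w m) = (c * sc x) *: fr m) ->
  exists s, s \notin p /\ exists a, (x * s) *: w = to_End_center M (x * a).
Proof.
move=> H; have [s [sp [a sa]]] := sc_num c.
have [|m|t tp Ht] := fg_uniform_denominator (p := p)
    (L := fun m => (x * s) *: val w m - (x * a) *: m = 0) hM.
- split=> [|b u v hu hv]; first by rewrite linear0 !scaler0 subrr.
  rewrite linearP !scalerDr opprD addrACA hv addr0.
  by rewrite !scalerA ![_ * b]mulrC -![(b * _) *: _]scalerA -scalerBr hu scaler0.
- have /fr_eq0[t tp tm] : fr (p := p) ((x * s) *: val w m - (x * a) *: m) = 0.
    rewrite frB !frZ (mulrC x s) (scM p s) -[(sc s * _) *: _]scalerA H scalerA.
    by rewrite mulrA sa -scM (mulrC a) subrr.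
  exists t => //; rewrite linearZ_LR.
  by rewrite !scalerA ![_ * t]mulrC -![(t * _) *: _]scalerA -scalerBr tm.
exists (t * s); split; first exact: notin_primeM.
exists (t * a); apply: val_inj; apply: End_ext => m.
change ((x * (t * s)) *: val w m = (x * (t * a)) *: m).
apply/eqP; rewrite -subr_eq0; apply/eqP; rewrite -[RHS](Ht m) (linearZ_LR (val w)) !scalerA.
by congr (_ *: _ - _ *: _); ring.
Qed.

End LocalizedEndomorphisms.

(** * Central endomorphisms as scalars *)

Section CentralScalars.
Variables (A : comNzRingType) (N : lmodType A).

(** The commutant of a socle. Here [x] spans a simple submodule of [A], so
    [x N] is a vector space over the residue field; for a maximal submodule [L]
    avoiding [n], the maps [l + a n |-> a w] with [w] in [x N] are endomorphisms of
    [N], and commutation with them makes [z] act on [x N] by one scalar. *)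
Lemma center_socle_scalar (x : A) (n : N) (z : End_center N) :
  (forall a, a * x = 0 \/ exists b, b * a = 1) -> x *: n <> 0 ->
  exists c, x *: z = to_End_center N (c * x).
Proof.
move=> hx xn.
have [|L [sL L0L nL maxL]] := exists_maximal_avoiding (L0 := fun v => x *: v = 0) _ xn.
  split=> [|a u v xu xv]; first exact: scaler0.
  by rewrite scalerDr scalerA mulrC -scalerA xu xv scaler0 addr0.
(* By maximality of [L] a multiple [b v] is congruent to [n]; if [b] were not a
   unit, [b v] would be killed by [x] and so belong to [L]. *)
have dec v : exists a, L (v - a *: n).
  have [Lv|/maxL[b Lb]] := pselect (L v); first by exists 0; rewrite scale0r subr0.
  have [bx|[c cb]] := hx b.
    case: nL; rewrite -[n](subrK (b *: v)); apply: submoduleD => //; apply: L0L.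
    by rewrite scalerA mulrC bx scale0r.
  exists c; rewrite -opprB -scaleN1r; apply: submoduleZ => //.
  have := submoduleZ c sL Lb; congr (L _).
  by rewrite scalerBr scalerA cb scale1r.
have killL a : L (a *: n) -> a * x = 0.
  move=> La; have [//|[b ba]] := hx a; case: nL.
  by have := submoduleZ b sL La; rewrite scalerA ba scale1r.
have [c Lc] := dec (val z n); exists c.
apply: val_inj; apply: End_ext => y.
have [v|a u v ? ? [b Lb ->] [d Ld ->]|w [a La ->]|h hG] := graph_linear
    (G := fun v w => exists2 a, L (v - a *: n) & w = a *: (x *: y)).
- by have [a La] := dec v; exists (a *: (x *: y)), a.
- exists (a * b + d); last by rewrite scalerDl scalerA.
  have := sL.2 a _ _ Lb Ld; congr (L _).
  by rewrite scalerBr scalerDl scalerA opprD addrACA.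
- rewrite scalerA (killL a) ?scale0r //.
  by have := submoduleZ (-1) sL La; rewrite sub0r scaleN1r opprK.
have hE v a : L (v - a *: n) -> h v = a *: (x *: y).
  move=> La; have [b Lb ->] := hG v; rewrite !scalerA; congr (_ *: _).
  apply/eqP; rewrite -subr_eq0 -mulrBl; apply/eqP/killL.
  have := submoduleB sL La Lb; congr (L _).
  by rewrite scalerBl opprD opprK addrACA subrr add0r addrC.
have /(congr1 (fun f : End N => f n)) := centralP _ (valP z) (h : End N).
rewrite !End_mulE (hE _ _ Lc) (hE n 1); last by rewrite scale1r subrr; case: sL.
rewrite scale1r (linearZ_LR (val z)) => zy.
by change (x *: val z y = (c * x) *: y); rewrite zy scalerA.
Qed.

Section Independent.
Variables (V : lmodType A) (B : set V).
Hypothesis Bfree : linearly_independent B.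

Lemma independent1 e a : B e -> a *: e = 0 -> a = 0.
Proof.
move=> Be ae; apply: (Bfree (s := [:: e]) (c := fun=> a) _ _ _ (mem_head e [::])) => //.
  by move=> v; rewrite inE => /eqP ->.
by rewrite big_seq1.
Qed.

Lemma independent2 e f a b : B e -> B f -> e <> f -> a *: e + b *: f = 0 ->
  a = 0.
Proof.
move=> Be Bf /eqP ef abe.
have := Bfree (s := [:: e; f]) (c := fun v => if v == e then a else b) _ _ _ (mem_head e _).
rewrite eqxx; apply=> [|v|]; first by rewrite /= inE ef.
  by rewrite !inE => /orP[] /eqP ->.
by rewrite big_cons big_seq1 eqxx eq_sym (negPf ef).
Qed.

End Independent.

Lemma scale_to_End_center a b :
  a *: to_End_center N b = to_End_center N (a * b).
Proof. by apply: val_inj; apply: End_ext => y; apply: scalerA. Qed.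

(** If every central [z] becomes a homothety after multiplication by some [r]
    that is regular on a nonzero submodule [A x] of [A], then two basis elements
    of the center would be proportional; hence the center is [A e] for one [e],
    and [z e = a e] forces [z = a]. *)
Lemma free_center_homotheties (x : A) :
  free_module (End_center N) -> x <> 0 ->
  (forall z : End_center N, exists r c, (r * x) *: z = to_End_center N (c * x) /\
     forall d, r * (d * x) = 0 -> d * x = 0) ->
  forall z : End_center N, exists a, z = to_End_center N a.
Proof.
move=> [B [Bfree Bgen]] x0 hz z.
have Buniq e f : B e -> B f -> e = f.
  move=> Be Bf; have [//|ef] := pselect (e = f); case: x0.
  have [r [c [re rx]]] := hz e; have [s [d [sf sx]]] := hz f.
  suff dx : d * x = 0.
    rewrite -[x]mul1r; apply: sx; rewrite mul1r; apply: (independent1 Bfree Bf).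
    by rewrite sf dx rmorph0.
  apply: rx; have -> : r * (d * x) = d * (r * x) by ring.
  apply: (independent2 Bfree (f := f) (b := - (c * (s * x))) Be Bf ef).
  rewrite -scalerA re scaleNr -scalerA sf !scale_to_End_center.
  by rewrite mulrCA subrr.
have [zall|/existsNP[w w0]] := pselect (forall w : End_center N, w = 0).
  by exists 0; rewrite rmorph0; apply: zall.
have [e Be] : exists e, B e.
  apply: contrapT => nB; apply: w0; have [[|v s] [sB sw]] := Bgen w.
    by move/in_span_nil: sw.
  by case: nB; exists v; apply: sB; apply: mem_head.
have eE v : exists a, v = a *: e.
  have [s [sB sv]] := Bgen v; apply: (in_span_sub (L := fun v => exists a, v = a *: e)) sv.
    split=> [|a u w' [b ->] [c ->]]; first by exists 0; rewrite scale0r.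
    by exists (a * b + c); rewrite scalerDl scalerA.
  by move=> w' /sB /(Buniq e) <- //; exists 1; rewrite scale1r.
have [a ze] := eE (z * e); exists a; have [b one] := eE (to_End_center N 1).
have comm_b (u : End_center N) y : val u y = b *: val u (val e y).
  have : 1 *: y = b *: val e y := congr1 (fun f : End_center N => val f y) one.
  by rewrite scale1r => {1}->; rewrite (linearZ_LR (val u)).
apply: val_inj; apply: End_ext => y; rewrite comm_b.
have zey : val z (val e y) = a *: val e y :=
  congr1 (fun f : End_center N => val f y) ze.
rewrite zey.
by change (b *: (a *: val e y) = a *: y); rewrite scalerA mulrC -scalerA -(comm_b 1).
Qed.

End CentralScalars.

Section CentersBasics.
Variables (A : comNzRingType) (N : lmodType A).

Lemma to_End_center_eq0 a : to_End_center N a = 0 <-> forall n : N, a *: n = 0.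
Proof.
split=> [a0 n|a0]; last by apply: val_inj; apply: End_ext => n; apply: a0.
exact: (congr1 (fun f : End_center N => val f n) a0).
Qed.

Lemma to_End_center_bij :
  (forall a, (forall n : N, a *: n = 0) -> a = 0) ->
  (forall z : End_center N, exists a, z = to_End_center N a) ->
  bijective (to_End_center N).
Proof.
move=> inj /choice[g gE]; exists g => [a|z]; last by rewrite -gE.
apply/eqP; rewrite -subr_eq0; apply/eqP/inj/to_End_center_eq0.
rewrite rmorphB /= -gE; exact: subrr.
Qed.

Lemma End_center_mulZ a (z w : End_center N) : z * (a *: w) = a *: (z * w).
Proof. by apply: val_inj; apply: End_ext => n; apply: (linearZ_LR (val z)). Qed.

Lemma free_center_faithful a :
  free_module (End_center N) -> (exists n : N, n <> 0) ->
  (forall n : N, a *: n = 0) -> a = 0.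
Proof.
move=> [B [Bfree Bgen]] [n n0] aN.
have [[|e s] [sB s1]] := Bgen (to_End_center N 1).
  by move/in_span_nil/to_End_center_eq0/(_ n): s1; rewrite scale1r.
apply: (independent1 Bfree (sB e (mem_head _ _))).
by apply: val_inj; apply: End_ext => m; apply: aN.
Qed.

Lemma free_singleton (V : lmodType A) (e : V) :
  (forall a, a *: e = 0 -> a = 0) -> (forall v, exists a, v = a *: e) ->
  free_module V.
Proof.
move=> e_inj e_gen; exists (fun v => v = e); split=> [s c us sB|v].
  case: s us sB => // v [_ sB|w s us sB].
    have -> : v = e by apply: (sB v); rewrite mem_head.
    by rewrite big_seq1 => ce w; rewrite inE => /eqP ->; apply: e_inj.
  have ve : v = e by apply: (sB v); rewrite mem_head.
  have we : w = e by apply: (sB w); rewrite !inE eqxx orbT.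
  by move: us; rewrite ve we /= mem_head.
have [a va] := e_gen v; exists [:: e]; split; first by move=> w; rewrite inE => /eqP.
by apply/in_span_cons; exists a, 0; split; [apply/in_span_nil | rewrite addr0].
Qed.

End CentersBasics.

(** * Associated primes of the ring *)

Section AssociatedPrimes.
Variable R : comNzRingType.
Implicit Types (p q : prime_idealr R) (x : R).

Definition annihilates q x := forall a, a \in q <-> a * x = 0.

Lemma annihilates_Ass q x : annihilates q x -> Ass R^o q.
Proof. by move=> qx; exists x => a; apply/idP/eqP => /qx. Qed.

(** The hypothesis says that [x] does not vanish at [p]; the associated prime [q]
    obtained from [x] then lies below [p]. *)
Lemma exists_annihilates p x : noetherian R -> (forall s, s \notin p -> s * x <> 0) ->
  exists b q, annihilates q (b * x) /\ forall a, a \in q -> a \in p.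
Proof.
move=> hR px.
have [|s t|s|b [q [qb qp]]] := @exists_prime_colon R R^o (fun v => v = 0)
    (fun s => s \notin p) x hR (@submodule_zero _ _).
- exact: notin_prime1.
- exact: notin_primeM.
- exact: px.
exists b, q; split=> [a|a aq]; first by rewrite qb mulrA.
by apply: contraT => /qp; rewrite aq.
Qed.

Lemma exists_annihilates_mul x : noetherian R -> x <> 0 ->
  exists b q, annihilates q (b * x).
Proof.
move=> hR x0.
have [//|s t -> ->|s ->|b [q [qb qp]]] := @exists_prime_colon R R^o (fun v => v = 0)
    (fun s => s = 1) x hR (@submodule_zero _ _).
- by rewrite mulr1.
- by rewrite scale1r.
by exists b, q => a; rewrite qb mulrA.
Qed.

Section At.
Variables (q : prime_idealr R) (x : R).
Hypothesis qx : annihilates q x.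

(** After localization at [q = ann x], the element [x] spans a copy of the residue
    field. *)
Lemma sc_annihilates (a : locring q) : a * sc x = 0 \/ exists b, b * a = 1.
Proof.
have [r [rq [b rab]]] := sc_num a.
have [bq|bq] := boolP (b \in q); [left|right].
  apply: (@sc_inj _ _ R^o r) => //.
  change (sc r * (a * sc x) = sc r * 0).
  by rewrite mulrA rab -scM ((qx b).1 bq) mulr0.
by have [u ub] := sc_unit bq; exists (u * sc r); rewrite -mulrA rab.
Qed.

Lemma sc_annihilates_neq0 : sc x <> 0 :> locring q.
Proof. by move=> /sc_eq0[s sq sx]; move: sq; rewrite (qx s).2. Qed.

(** At an associated prime the maximal ideal consists of zero divisors. *)
Lemma depth_associated : (depth (locring q) <= 1)%E.
Proof.
apply/(depth_le _ 1) => -[//|a s] sm [sreg _].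
have [ax|[b ba]] := sc_annihilates a; last by case: (sm a (mem_head _ _) b).
case: sc_annihilates_neq0; apply/(@in_span_nil _ (locring q)^o)/(sreg 0%N isT).
by apply/(@in_span_nil _ (locring q)^o).
Qed.

End At.

End AssociatedPrimes.

(** * Free and projective centers *)

Section Equivalence.
Variables (R : comNzRingType) (M : lmodType R).
Hypotheses (hR : noetherian R) (hM : finitely_generated M).

Lemma loc_eq0_uniform (p : prime_idealr R) a :
  (forall m : M, fr (p := p) (a *: m) = 0) ->
  exists2 s, s \notin p & forall m : M, (s * a) *: m = 0.
Proof.
move=> H; have [|m|s sp Hs] := fg_uniform_denominator (p := p)
    (L := fun m => a *: m = 0) hM.
- split=> [|c u v u0 v0]; first exact: scaler0.
  by rewrite scalerDr scalerA mulrC -scalerA u0 v0 scaler0 addr0.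
- have /fr_eq0[s sp sm] := H m; exists s => //.
  by rewrite scalerA mulrC -scalerA.
by exists s => // m; rewrite mulrC -scalerA.
Qed.

Lemma Supp_annihilator (p : prime_idealr R) a :
  Supp M p -> (forall m : M, a *: m = 0) -> a \in p.
Proof.
move=> [z /eqP z0] aM; apply: contraT => ap; case: z0.
have [s [sp [x zx]]] := fr_num z.
apply: (sc_inj sp); rewrite zx scaler0; apply/fr_eq0; exists a => //.
Qed.

Lemma annihilator_Supp (p : prime_idealr R) :
  (forall a, (forall m : M, a *: m = 0) -> a \in p) -> Supp M p.
Proof.
move=> H; apply: contrapT => nS.
have [m|s sp sM] := @loc_eq0_uniform p 1.
  by apply: contrapT => /eqP m0; apply: nS; exists (fr (1 *: m)).
by move: sp; rewrite H // => m; rewrite -[s]mulr1.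
Qed.

(** The socle argument at [q = ann x], with denominators cleared. *)
Lemma center_at_annihilator (q : prime_idealr R) (x : R) (w : End_center M) :
  annihilates q x -> (forall s, s \notin q -> exists m : M, (s * x) *: m <> 0) ->
  exists s, s \notin q /\ exists a, (x * s) *: w = to_End_center M (x * a).
Proof.
move=> qx xM.
have [m xm] : exists m : M, sc x *: fr (p := q) m <> 0.
  apply: contrapT => nm; have [m|s sq sxM] := @loc_eq0_uniform q x.
    by apply: contrapT => xm; apply: nm; exists m; rewrite -frZ.
  by have [m] := xM s sq; apply.
have [z zE] := loc_center q hR hM w.
have [c xz] := center_socle_scalar z (sc_annihilates qx) xm.
apply: (loc_homothety hM (c := c)) => m'; rewrite -zE.
exact: (congr1 (fun f : End_center (locmod q M) => val f (fr m')) xz).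
Qed.

(** If [s] outside [q = ann b] killed [b M], it would kill [b] itself, because
    [R] acts faithfully on a nonzero [M] with free center; so the socle argument
    applies at any associated prime [q] of [R]. *)
Lemma free_center_bij : (exists x : M, x != 0) -> free_module (End_center M) ->
  bijective (to_End_center M).
Proof.
move=> [n /eqP n0] freeZ.
have faithful a : (forall m : M, a *: m = 0) -> a = 0.
  by apply: free_center_faithful => //; exists n.
have [b [q]] := exists_annihilates_mul hR (elimN eqP (@oner_neq0 R)).
rewrite mulr1 => qb; apply: to_End_center_bij => //.
apply: (free_center_homotheties (x := b)) => // [b0|z].
  by have := notin_prime1 q; rewrite (qb 1).2 // b0 mulr0.
have [s sq|s [sq [a sz]]] := center_at_annihilator z qb.
  apply: contrapT => nM; move: sq; rewrite (qb s).2 //; apply: faithful => m.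
  by apply: contrapT => sm; apply: nM; exists m.
exists s, a; split=> [|d sd]; first by rewrite mulrC sz mulrC.
apply/qb; have /qb : s * d * b = 0 by rewrite -mulrA.
by rewrite prime_idealrM (negPf sq).
Qed.

Lemma dual_basis (V : lmodType R) : finitely_generated V -> projective_module V ->
  exists n (z : 'I_n -> V) (f : 'I_n -> {linear V -> R^o}),
    forall v, v = \sum_(i < n) (f i v : R) *: z i.
Proof.
move=> /fg_presented[n [z zV]] pV.
have [h hE] := pV _ _ (comb z) (idfun : {linear V -> V}) zV.
exists n, z, (fun i => @row_coord R n i \o h : {linear V -> R^o}) => v.
by rewrite -[LHS](hE v) combE.
Qed.

(** At an associated prime [q] of [R] the center is [R] up to denominators; its
    elements are detected at these primes, because projectivity embeds it in a
    power of [R]. *)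
Lemma projective_center_bij : (forall p : prime_idealr R, Supp M p) ->
  projective_module (End_center M) -> bijective (to_End_center M).
Proof.
move=> supp projZ.
have fgZ := fg_noetherian (noetherian_center hR hM).
have [n [z [f fE]]] := dual_basis fgZ projZ.
(* A vector of [Z] killed by [x] has its coordinates in [ann x = q]. *)
have kill q x s (v : End_center M) i : annihilates q x -> s \notin q ->
    (s * x) *: v = 0 -> (f i v : R) \in q.
  move=> qx sq xv; have : s * (f i v : R) \in q.
    apply/qx; transitivity ((s * x) * (f i v : R)); first by ring.
    by have := linearZ_LR (f i) (s * x) v; rewrite xv linear0 => /esym.
  by rewrite prime_idealrM (negPf sq).
(* If [s x] killed [M], it would kill [Z], so that [Z = q Z] and Nakayama's
   lemma would remove [q] from the support of [M]. *)
have visible q x : annihilates q x ->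
    forall s, s \notin q -> exists m : M, (s * x) *: m <> 0.
  move=> qx s sq; apply: contrapT => nM.
  have xZ (v : End_center M) : (s * x) *: v = 0.
    apply: val_inj; apply: End_ext => m; apply: contrapT => sm.
    by apply: nM; exists (val v m).
  have [v|t tq tZ] := @nakayama _ q _ (fun v => v = 0) fgZ (@submodule_zero _ _).
    exists 1; split; first exact: notin_prime1.
    exists v; last by rewrite scale1r subrr.
    exists n, (fun i => f i v), z; split; last exact: fE.
    by move=> i; apply: (kill _ _ _ _ _ qx sq).
  move: tq; rewrite (Supp_annihilator (supp q)) // => m.
  by have := congr1 (fun w : End_center M => val w m) (tZ (to_End_center M 1));
    rewrite /= => <-; rewrite scale1r.
have local_scalar q x : annihilates q x ->
    exists2 s, s \notin q & forall v, exists a, s *: v = to_End_center M a.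
  move=> qx.
  apply: (nakayama (L := fun v => exists a, v = to_End_center M a) fgZ) => [|v].
    split=> [|a u v [b ->] [c ->]]; first by exists 0; rewrite rmorph0.
    by exists (a * b + c); rewrite scale_to_End_center -rmorphD.
  have [s [sq [a sv]]] := center_at_annihilator v qx (visible q x qx).
  exists s; split=> //; exists (s *: v - to_End_center M a); last first.
    by exists a; rewrite subKr.
  exists n, (fun i => f i (s *: v - to_End_center M a)), z; split; last exact: fE.
  move=> i; apply: (kill _ _ 1 _ _ qx (notin_prime1 q)).
  by rewrite mul1r scalerBr scalerA sv scale_to_End_center subrr.
(* If the difference [y] is nonzero, one of its coordinates is; its multiple
   with annihilator [q] is a witness that [y] survives at [q]. *)
have rank1 i (v w : End_center M) : (f i v : R) *: w = (f i w : R) *: v.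
  apply/eqP; rewrite -subr_eq0; apply/eqP; set y := _ - _.
  apply: contrapT => y0.
  have [j fy0] : exists j, (f j y : R) <> 0.
    apply: contrapT => nj; apply: y0; rewrite (fE y) big1 // => j _.
    have -> : (f j y : R) = 0 by apply: contrapT => fj; apply: nj; exists j.
    by rewrite scale0r.
  have [b [q qx]] := exists_annihilates_mul hR fy0.
  have [s sq Hs] := local_scalar q _ qx.
  have [c sv] := Hs v; have [d sw] := Hs w.
  have sy : (s * s) *: y = 0.
    have fc a u : s *: u = to_End_center M a ->
        s * (f i u : R) = a * (f i (to_End_center M 1) : R).
      move=> su; have := linearZ_LR (f i) s u; rewrite su => /esym.
      rewrite -[a in to_End_center M a]mulr1 -scale_to_End_center.
      by rewrite (linearZ_LR (f i)).
    rewrite /y scalerBr !scalerA.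
    have E u1 u2 : (s * s * (f i u1 : R)) *: u2 = (s * (f i u1 : R)) *: (s *: u2).
      by rewrite scalerA; congr (_ *: _); ring.
    rewrite !E sv sw (fc _ _ sv) (fc _ _ sw) !scale_to_End_center.
    have -> : c * (f i (to_End_center M 1) : R) * d =
        d * (f i (to_End_center M 1) : R) * c by ring.
    exact: subrr.
  have : s * s \in q.
    apply/qx; have := linearZ_LR (f j) (s * s) y; rewrite sy linear0 => /esym h.
    have {}h : s * s * (f j y : R) = 0 by [].
    by rewrite mulrCA h mulr0.
  by rewrite prime_idealrM (negPf sq).
apply: to_End_center_bij => [a aM|v].
  apply: contrapT => a0; have [b [q qx]] := exists_annihilates_mul hR a0.
  have [m] := visible q _ qx 1 (notin_prime1 q); apply.
  by rewrite mul1r -scalerA aM scaler0.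
exists (\sum_(i < n) (f i (v * z i) : R)).
have vE : v = \sum_(i < n) (f i (to_End_center M 1) : R) *: (v * z i).
  transitivity (v * to_End_center M 1); first by rewrite rmorph1 mulr1.
  rewrite [X in v * X]fE.
  by rewrite mulr_sumr; apply: eq_bigr => i _; rewrite End_center_mulZ.
rewrite [LHS]vE rmorph_sum; apply: eq_bigr => i _ /=.
by rewrite -rank1 scale_to_End_center mulr1.
Qed.

End Equivalence.

(** * Consequences of a bijection, and the condition in depth at most one *)

Section Isomorphism.
Variables (R : comNzRingType) (M : lmodType R).
Hypotheses (hR : noetherian R) (hM : finitely_generated M).

Section FromBijection.
Hypothesis bij : bijective (to_End_center M).

Lemma bij_faithful a : (forall m : M, a *: m = 0) -> a = 0.
Proof.
move=> aM; apply: (bij_inj bij); rewrite rmorph0.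
exact/to_End_center_eq0.
Qed.

Lemma bij_homothety z : exists a, z = to_End_center M a.
Proof. by have [g _ gK] := bij; exists (g z); rewrite gK. Qed.

Lemma bij_algebra_iso : exists f : {rmorphism End_center M -> R},
  (forall a z, f (a *: z) = a * f z) /\ bijective f.
Proof.
have [g toK gK] := bij.
have gB : zmod_morphism g.
  by move=> u v; apply: (bij_inj bij); rewrite rmorphB /= !gK.
have gM : monoid_morphism g.
  split=> [|u v]; apply: (bij_inj bij); first by rewrite gK rmorph1.
  by rewrite rmorphM /= !gK.
pose f : {rmorphism End_center M -> R} := HB.pack g
  (GRing.isZmodMorphism.Build (End_center M) R g gB)
  (GRing.isMonoidMorphism.Build (End_center M) R g gM).
exists f; split=> [a z|]; last by exists (to_End_center M).
by apply: (bij_inj bij); rewrite -scale_to_End_center /= !gK.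
Qed.

Lemma bij_Supp p : Supp M p.
Proof. by apply: annihilator_Supp => // a /bij_faithful ->; apply: idealr0. Qed.

Lemma bij_projective : projective_module (End_center M).
Proof.
move=> N P g f gsurj; have [n gn] := gsurj (f (to_End_center M 1)).
have [z|a u v w x [b -> ->] [c -> ->]|w [b b0 ->]|h hG] := graph_linear
    (G := fun z w => exists2 b, z = to_End_center M b & w = b *: n).
- by have [b zb] := bij_homothety z; exists (b *: n), b.
- exists (a * b + c); last by rewrite scalerDl scalerA.
  by rewrite scale_to_End_center -rmorphD.
- have -> : b = 0 by apply: (bij_inj bij); rewrite rmorph0.
  exact: scale0r.
exists h => z; have [b -> ->] := hG z.
by rewrite linearZ gn -[b in RHS]mulr1 -scale_to_End_center linearZ.
Qed.

Lemma bij_Ass p : Ass (End_center M) p <-> Ass R^o p.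
Proof.
have to0 a b : (a *: to_End_center M b == 0) = (a * b == 0).
  by rewrite scale_to_End_center -(inj_eq (bij_inj bij)) rmorph0.
split=> [[z zp]|[b bp]].
  have [b zb] := bij_homothety z; exists b => a.
  by rewrite zp zb to0.
by exists (to_End_center M b) => a; rewrite to0 bp.
Qed.

Lemma bij_loc_free p : free_module (End_center (locmod p M)).
Proof.
apply: (free_singleton (e := to_End_center _ 1)) => [a|z].
  rewrite scale_to_End_center mulr1 => /to_End_center_eq0 aM.
  have [s [sp [b ab]]] := sc_num a.
  have [m|t tp tM] := @loc_eq0_uniform R M hM p b.
    by rewrite frZ -ab -scalerA aM scaler0.
  apply: (@sc_inj _ _ R^o s) => //.
  change (sc s * a = sc s * 0).
  rewrite ab mulr0; apply/sc_eq0; exists t => //; exact: bij_faithful.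
have [w [s [sp zw]]] := loc_center_num hR hM z.
have [c wc] := bij_homothety w; have [u us] := sc_unit sp.
exists (u * sc c); rewrite scale_to_End_center mulr1.
apply: val_inj; apply: End_ext; apply: frac_eqP => m; apply: (sc_inj sp).
change (sc s *: val z (fr m) = sc s *: ((u * sc c) *: fr m)).
by rewrite zw wc scalerA mulrA (mulrC (sc s)) us mul1r -frZ.
Qed.

End FromBijection.

Lemma module_iso_free : (exists f : {linear End_center M -> R^o}, bijective f) ->
  (exists x : M, x != 0) /\ free_module (End_center M).
Proof.
move=> [f fbij]; have [g fK gK] := fbij; split.
  apply: contrapT => M0; have := oner_neq0 R; have -> : 1 = 0 :> R; last by rewrite eqxx.
  rewrite -[LHS](gK 1) -[RHS](linear0 f); congr (f _); apply: val_inj; apply: End_ext => m.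
  by apply: contrapT => /eqP m0; apply: M0; exists (val (g 1) m).
apply: (free_singleton (e := g 1)) => [a ag|z].
  have := linearZ_LR f a (g 1); rewrite ag linear0 gK => /esym.
  by move=> h; rewrite -[a]mulr1.
exists (f z); apply: (bij_inj fbij); rewrite linearZ_LR gK.
exact/esym/mulr1.
Qed.

Section FromDepthOne.
Hypothesis hAss : forall p : prime_idealr R, Ass (End_center M) p <-> Ass R^o p.
Hypothesis hfree : forall p : prime_idealr R, (depth (locring p) <= 1)%E ->
  free_module (End_center (locmod p M)).

Lemma loc_neq0_associated (q : prime_idealr R) (x : R) :
  annihilates q x -> exists m : locmod q M, m <> 0.
Proof.
move=> qx; have [y qy] := (hAss q).2 (annihilates_Ass qx).
suff [z /eqP z0] : Supp M q by exists z.
apply: annihilator_Supp => // a aM; rewrite qy; apply/eqP.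
by apply: val_inj; apply: End_ext => m; apply: aM.
Qed.

Lemma loc_faithful_associated (q : prime_idealr R) (x : R) (a : locring q) :
  annihilates q x -> (forall m : locmod q M, a *: m = 0) -> a = 0.
Proof.
move=> qx; apply: free_center_faithful; last exact: loc_neq0_associated qx.
exact/hfree/(depth_associated qx).
Qed.

Lemma loc_homotheties_associated (q : prime_idealr R) (x : R)
    (z : End_center (locmod q M)) :
  annihilates q x -> exists a, z = to_End_center _ a.
Proof.
move=> qx; have x0 := sc_annihilates_neq0 qx.
have [m xm] : exists m : locmod q M, sc x *: m <> 0.
  apply: contrapT => nm; apply: x0; apply: (loc_faithful_associated qx) => m.
  by apply: contrapT => xm; apply: nm; exists m.
move: z; apply: (free_center_homotheties (x := sc x)) => // [|z].
  exact/hfree/(depth_associated qx).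
have [c xz] := center_socle_scalar z (sc_annihilates qx) xm.
by exists 1, c; rewrite mul1r; split=> // d; rewrite mul1r.
Qed.

(** Every [z] becomes a homothety after multiplication by a denominator at an
    associated prime [q] below [p], and such a denominator is regular on the
    submodule generated by an element with annihilator [q]; so the rank of the
    free module at [p] is one. *)
Lemma loc_homotheties_depth1 (p : prime_idealr R) (z : End_center (locmod p M)) :
  (depth (locring p) <= 1)%E -> exists a, z = to_End_center _ a.
Proof.
move=> dp; have [s sp|b [q []]] := @exists_annihilates R p 1 hR.
  by rewrite mulr1 => s0; move: sp; rewrite s0 idealr0.
rewrite mulr1 => qb qp.
have pq s : s \notin p -> s \notin q by apply: contra; apply: qp.
have b0 : sc b <> 0 :> locring p.
  by move=> /sc_eq0[s /pq sq sb]; move: sq; rewrite (qb s).2.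
move: z; apply: (free_center_homotheties (x := sc b)) => // [|z]; first exact: hfree.
have [w [s [sp zw]]] := loc_center_num hR hM z.
have [wq wqE] := loc_center q hR hM w.
have [c wc] := loc_homotheties_associated wq qb.
have [m|t [tq [a]]] := @loc_homothety R q M hM w 1 c.
  by rewrite sc1 mulr1 scale1r -wqE wc.
rewrite !mul1r => tw.
exists (sc (t * s)), (sc a); split.
  apply: val_inj; apply: End_ext; apply: frac_eqP => m.
  change ((sc (t * s) * sc b) *: val z (fr m) = (sc a * sc b) *: fr m).
  have twm : t *: val w m = a *: m := congr1 (fun f : End_center M => val f m) tw.
  have -> : sc (t * s) * sc b = (sc b * sc t) * sc s :> locring p by rewrite scM; ring.
  by rewrite -scalerA zw -scalerA -frZ twm frZ scalerA mulrC.
move=> d; have [r [rp [e de]]] := sc_num d.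
move=> /(congr1 ( *%R (sc r))); rewrite mulr0.
have -> : sc r * (sc (t * s) * (d * sc b)) = sc (t * s * (e * b)) :> locring p.
  by rewrite !scM -de; ring.
move=> /sc_eq0[v /pq vq vb].
have eq : e \in q.
  have : v * (t * s * e) \in q by apply/qb; rewrite -[RHS]vb; ring.
  by rewrite !prime_idealrM (negPf vq) (negPf tq) (negPf (pq _ sp)).
apply: (@sc_inj _ _ R^o r) => //.
change (sc r * (d * sc b) = sc r * 0).
by rewrite mulrA de -scM ((qb e).1 eq) mulr0.
Qed.

Lemma depth1_faithful a : (forall m : M, a *: m = 0) -> a = 0.
Proof.
move=> aM; apply: contrapT => a0.
have [b [q qx]] := exists_annihilates_mul hR a0.
have : sc a = 0 :> locring q.
  apply: (loc_faithful_associated qx) => z; have [s [sq [m zm]]] := fr_num z.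
  apply: (sc_inj sq); rewrite scalerA mulrC -scalerA zm -frZ aM scaler0.
  exact: fr0.
move=> /sc_eq0[s sq sa]; move: sq.
by rewrite (qx s).2 // mulrCA sa mulr0.
Qed.

(** If [a, b] is a regular sequence at [p], then [a z] and [b z] are
    scalars [alpha] and [beta] with [b alpha = a beta]; hence [alpha = a gamma], and
    [a (z - gamma) = 0]. As [a] avoids the associated primes of [R], which are
    those of the center, [z = gamma] at [p]. *)
Lemma depth_conductor (p : prime_idealr R) (z : End_center M) :
  (forall a, a \in p <-> exists c, a *: z = to_End_center M c) ->
  (depth (locring p) <= 1)%E.
Proof.
move=> pz; apply/(depth_le _ 1) => -[//|a [//|b l]] sm [sreg _]; exfalso.
have maximal (d : locring p) : nonunits d ->
    exists s, s \notin p /\ exists2 e, e \in p & sc s * d = sc e.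
  move=> du; have [s [sp [e de]]] := sc_num d; exists s; split=> //; exists e => //.
  apply: contraT => /sc_unit[u ue].
  by case: (du (u * sc s)); rewrite -mulrA de.
have [s [sp [a' ap sa]]] := maximal a (sm _ (mem_head _ _)).
have [t [tp [b' bp tb]]] : exists t, t \notin p /\
    exists2 e, e \in p & sc t * b = sc e.
  by apply: maximal; apply: sm; rewrite !inE eqxx orbT.
have areg (d : locring p) : a * d = 0 -> d = 0.
  move=> ad; apply/(@in_span_nil _ (locring p)^o)/(sreg 0%N isT).
  exact/(@in_span_nil _ (locring p)^o).
have [alpha az] := (pz a').1 ap; have [beta bz] := (pz b').1 bp.
have ab : b' * alpha = a' * beta.
  apply/eqP; rewrite -subr_eq0; apply/eqP/depth1_faithful/to_End_center_eq0.
  by rewrite rmorphB /= -!scale_to_End_center -az -bz !scalerA (mulrC a') subrr.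
have [gamma alphaE] : exists gamma, sc alpha = a * gamma :> locring p.
  have [|c [w [/in_span_nil -> ->]]] :=
      (@in_span_cons _ (locring p)^o a [::] (sc alpha)).1.
    apply: (sreg 1%N isT); apply/(@in_span_cons _ (locring p)^o).
    have [u ut] := sc_unit tp; exists (u * sc s * sc beta), 0; split.
      exact/(@in_span_nil _ (locring p)^o).
    rewrite addr0; change (b * sc alpha = u * sc s * sc beta * a).
    transitivity (u * (sc b' * sc alpha)); first by rewrite -tb !mulrA ut mul1r.
    by rewrite -scM ab scM -sa; ring.
  by exists c; rewrite addr0 mulrC.
have [h [hp [g gE]]] := sc_num gamma.
have /sc_eq0[u up ug] : sc (h * s * alpha - a' * g) = 0 :> locring p.
  have -> : sc (h * s * alpha - a' * g) = sc (h * s * alpha) - sc (a' * g) :> locring p.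
    exact: (@frB _ _ R^o).
  rewrite !scM alphaE -sa -gE.
  by apply/eqP; rewrite subr_eq0; apply/eqP; ring.
pose y := (u * h * s) *: z - to_End_center M (u * g).
have ay : a' *: y = 0.
  rewrite /y scalerBr scalerA mulrC -scalerA az !scale_to_End_center -rmorphB.
  rewrite -[RHS](rmorph0 (to_End_center M)); congr to_End_center.
  by rewrite -[RHS]ug; ring.
have [v vp vy] : exists2 v, v \notin p & v *: y = 0.
  apply: contrapT => ny.
  have [|c d cp dp|v vp vy|c [q [qy qp]]] := @exists_prime_colon R _ (fun v => v = 0)
      (fun s => s \notin p) y hR (@submodule_zero _ _).
  - exact: notin_prime1.
  - exact: notin_primeM.
  - by apply: ny; exists v.
  have [x qx] : exists x : R, forall d, (d \in q) = (d * x == 0).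
    have /hAss[x qx] : Ass (End_center M) q.
      by exists (c *: y) => d; rewrite scalerA; apply/idP/eqP => /qy.
    by exists x.
  have a'q : a' \in q by apply/qy; rewrite mulrC -scalerA ay scaler0.
  have /sc_eq0[v vp vx] : sc x = 0 :> locring p.
    apply: areg; apply: (@sc_inj _ _ R^o s) => //.
    change (sc s * (a * sc x) = sc s * 0).
    by rewrite mulrA sa -scM mulr0; move: a'q; rewrite qx => /eqP ->.
  have := qp v vp; rewrite qx; apply/negP/negPn/eqP; exact: vx.
have : v * (u * h * s) \in p.
  apply/pz; exists (v * (u * g)).
  rewrite -scalerA -scale_to_End_center; apply/eqP.
  by rewrite -subr_eq0 -scalerBr vy.
by apply/negP; rewrite !notin_primeM.
Qed.

Lemma depth1_center_bij : bijective (to_End_center M).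
Proof.
apply: to_End_center_bij => [a|z]; first exact: depth1_faithful.
apply: contrapT => nz.
pose L (w : End_center M) := exists a, w = to_End_center M a.
have sL : submodule L.
  split=> [|a u v [b ->] [c ->]]; first by exists 0; rewrite rmorph0.
  by exists (a * b + c); rewrite scale_to_End_center -rmorphD.
have [//|s t -> ->|s ->|b [p [pz _]]] := @exists_prime_colon R _ L
    (fun s => s = 1) z hR sL.
- by rewrite mulr1.
- by rewrite scale1r.
have {}pz a : a \in p <-> exists c, a *: (b *: z) = to_End_center M c.
  by rewrite scalerA.
(* At [p] the element [b z] is a homothety; clearing denominators puts some [s]
   outside [p] into its conductor. *)
have [zp zpE] := loc_center p hR hM (b *: z).
have [c zc] := loc_homotheties_depth1 zp (depth_conductor pz).
have [m|s [sp [a]]] := @loc_homothety R p M hM (b *: z) 1 c.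
  by rewrite sc1 mulr1 scale1r -zpE zc.
rewrite !mul1r => sz.
by move: sp; rewrite (pz s).2 //; exists a.
Qed.

End FromDepthOne.

End Isomorphism.

Unset Implicit Arguments.

Theorem proposition4p13 (R : comNzRingType) (M : lmodType R)
    (hR : noetherian R) (hM : finitely_generated M) :
  [<-> (* 1 *) bijective (to_End_center M);
       (* 2 *) exists f : {rmorphism End_center M -> R},
                 (forall (a : R) (z : End_center M), f (a *: z) = a * f z) /\ bijective f;
       (* 3 *) exists f : {linear End_center M -> R^o}, bijective f;
       (* 4 *) (exists x : M, x != 0) /\ free_module (End_center M);
       (* 5 *) (forall p : prime_idealr R, Supp M p) /\ projective_module (End_center M);
       (* 6 *) (forall p : prime_idealr R, Ass (End_center M) p <-> Ass R^o p) /\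
               (forall p : prime_idealr R, (depth (locring p) <= 1)%E ->
                  free_module (End_center (locmod p M)))].
Proof.
tfae.
- exact: bij_algebra_iso.
- move=> [f [fZ fbij]].
  have fl : linear (f : End_center M -> R^o).
    by move=> a u v; rewrite rmorphD fZ.
  pose g : {linear End_center M -> R^o} := HB.pack (f : End_center M -> R^o)
    (GRing.isLinear.Build R (End_center M) R^o *:%R _ fl).
  by exists g.
- exact: module_iso_free.
- move=> [M0 freeZ]; have bij := free_center_bij hR hM M0 freeZ.
  by split; [apply: bij_Supp | apply: bij_projective].
- move=> [supp projZ]; have bij := projective_center_bij hR hM supp projZ.
  by split=> p; [apply: bij_Ass | move=> _; apply: bij_loc_free].
- by move=> [hAss hfree]; apply: depth1_center_bij.
Qed.
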